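(* Let $G$ be a locally finite quasi-transitive graph. Then $G$ is quasi-isometric to a tree if and only if every locally finite quasi-transitive graph that is quasi-isometric to $G$ is minor excluded.
   Context: A graph is quasi-transitive if its automorphism group acts on its vertex set with only finitely many orbits. A graph $H$ is a minor of a graph $G$ if $H$ can be obtained from $G$ by contracting edges and deleting edges and vertices; equivalently, there are pairwise disjoint nonempty sets $G_x\subseteq V(G)$, $x\in V(H)$, each inducing a connected subgraph of $G$, such that whenever $xy\in E(H)$ there is an edge $uv\in E(G)$ with $u\in G_x$, $v\in G_y$. A graph is minor excluded if there exists some finite graph that is not a minor of it. For graphs $G,H$ with graph distances $d_G,d_H$, a map $\varphi\colon V(G)\to V(H)$ is a quasi-isometry if there exist $\gamma\ge 1$, $c\ge 0$ such that $\frac{1}{\gamma}d_H(\varphi(x),\varphi(y))-c\le d_G(x,y)\le \gamma d_H(\varphi(x),\varphi(y))+c$ for all $x,y\in V(G)$ and every vertex of $H$ lies within distance $c$ of $\varphi(V(G))$; $G$ is quasi-isometric to $H$ if such a map exists.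
   Formalization: G is additionally assumed to be connected (and nonempty); without this the statement fails, e.g. two isolated vertices are not quasi-isometric to a tree although every locally finite graph quasi-isometric to them is finite and so minor excluded. *)

(* Defs.v *)
From HB Require Import structures.
From mathcomp Require Import all_boot all_order all_algebra.
From mathcomp Require Import mathcomp_extra boolp classical_sets functions.
From mathcomp Require Import cardinality reals constructive_ereal ereal.

Set Implicit Arguments.
Unset Strict Implicit.
Unset Printing Implicit Defensive.

Import Order.TTheory GRing.Theory Num.Theory.

Local Open Scope classical_set_scope.
Local Open Scope ring_scope.

Record graph := Graph {
  vertex :> choiceType;
  adj : rel vertex;
  adj_sym : symmetric adj;
  adj_irrefl : irreflexive adj }.

Definition is_walk (G : graph) (x : G) (p : seq G) (y : G) : Prop :=
  path (@adj G) x p /\ last x p = y.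

(* The empty graph does not count as connected, hence is not a tree either. *)
Definition graph_connected (G : graph) : Prop :=
  inhabited G /\ forall x y : G, exists p : seq G, is_walk x p y.

Definition is_tree (G : graph) : Prop :=
  graph_connected G /\ forall c : seq G, (2 < size c)%N -> ~ ucycle (@adj G) c.

Definition locally_finite (G : graph) : Prop :=
  forall x : G, finite_set [set y : G | adj x y].

Definition is_automorphism (G : graph) (f : G -> G) : Prop :=
  bijective f /\ forall x y : G, adj (f x) (f y) = adj x y.

Definition aut_orbit (G : graph) (x : G) : set G :=
  [set y | exists2 f : G -> G, is_automorphism f & f x = y].

Definition quasi_transitive (G : graph) : Prop :=
  finite_set (range (@aut_orbit G)).

(* Extended graph distance: the infimum is +oo when no walk joins x to y. *)
Definition gdist (R : realType) (G : graph) (x y : G) : \bar R :=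
  ereal_inf [set ((size p)%:R)%:E | p in [set p : seq G | is_walk x p y]].

Definition is_quasi_isometry (R : realType) (G H : graph) (phi : G -> H) : Prop :=
  exists gamma c : R, [/\ 1 <= gamma, 0 <= c,
    forall x y : G,
      ((gamma^-1)%:E * gdist R (phi x) (phi y) - c%:E <= gdist R x y)%E /\
      (gdist R x y <= gamma%:E * gdist R (phi x) (phi y) + c%:E)%E &
    forall z : H, exists x : G, (gdist R z (phi x) <= c%:E)%E].

Definition quasi_isometric (R : realType) (G H : graph) : Prop :=
  exists phi : G -> H, is_quasi_isometry R phi.

Section Induced.
Variables (G : graph) (A : set G).

Definition induced_adj : rel (set_type A) := fun u v => adj (val u) (val v).

Fact induced_adj_sym : symmetric induced_adj.
Proof. by move=> u v; exact: adj_sym. Qed.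

Fact induced_adj_irrefl : irreflexive induced_adj.
Proof. by move=> u; exact: adj_irrefl. Qed.

Definition induced : graph := Graph induced_adj_sym induced_adj_irrefl.

End Induced.

Definition is_minor (H G : graph) : Prop :=
  exists B : H -> set G,
    [/\ forall x, B x !=set0,
        trivIset setT B,
        forall x, graph_connected (induced (B x)) &
        forall x y, adj x y -> exists u v, [/\ B x u, B y v & adj u v]].

Definition finite_graph (G : graph) : Prop := finite_set [set: G].

Definition minor_excluded (G : graph) : Prop :=
  exists2 H : graph, finite_graph H & ~ is_minor H G.

(* Main.v *)
Require Import Defs.
From HB Require Import structures.
From mathcomp Require Import all_boot all_order all_algebra.
From mathcomp Require Import mathcomp_extra boolp classical_sets functions.
From mathcomp Require Import cardinality reals constructive_ereal ereal.
From mathcomp Require Import zify lra.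

(** If [H] is quasi-isometric to a tree [T], thicken the images in [T] of the
branch sets of a complete minor of [H] to pairwise intersecting subtrees. By the
Helly property they have a common vertex, so every branch set meets one ball of
[H] of fixed radius, and balls of fixed radius have bounded size.

Conversely, fix a root of [G] and let [T] be the tree of components of the
complements of the balls around the root. If [G] is not quasi-isometric to [T],
Manning's bottleneck property fails at some vertex [m] for all radii: there are
[x] and [y] such that [m] lies on a geodesic between them, while they are joined
outside an arbitrarily large ball around [m]. A small separator between a ball
around [m] and the far connection would meet the geodesic on both sides of [m];
but minimal separators of bounded size have bounded diameter, as only finitely
many contain a given vertex and [G] is quasi-transitive. By Menger's theorem, [n]
disjoint connected sets lead from the ball to the far connection, and each of
them crosses [n] disjoint connected sets in concentric annuli. These rows and
columns, placed in the two copies of [G] in the prism over [G], form a complete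
minor. Hence the prism is not minor excluded. *)

Set Implicit Arguments.
Unset Strict Implicit.
Unset Printing Implicit Defensive.

Import Order.TTheory GRing.Theory Num.Theory.

(** * Hall's and Menger's theorems *)

Section Hall.
Variables L T : finType.
Implicit Types (N : L -> {set T}) (X Y : {set L}).

Definition hall_condition N :=
  [forall X : {set L}, #|X| <= #|\bigcup_(x in X) N x|].

(* Rado's argument: as long as some [N x] has two elements, submodularity of
   the cardinality shows that one of them can be deleted. *)
Lemma hall N : hall_condition N ->
  exists2 f : L -> T, injective f & forall x, f x \in N x.
Proof.
have [n] := ubnP (\sum_x #|N x|); elim: n N => // n IH N leN /forallP hN.
case: (pickP (fun x => 1 < #|N x|)) => [x /card_gt1P[y1 [y2 [y1x y2x y12]]]|N1].
  pose D y := fun z => if z == x then N x :\ y else N z.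
  have ltD y : y \in N x -> \sum_z #|D y z| < n.
    move=> yx; rewrite -ltnS; apply: leq_trans leN; rewrite ltnS.
    rewrite (bigD1 x) //= [leqRHS](bigD1 x) //= /D eqxx [#|N x|](cardsD1 y) yx.
    rewrite -addSn leq_add //; apply: leq_sum => z /negbTE->; exact: leqnn.
  have sub y z : D y z \subset N z.
    by rewrite /D; case: eqP => [->|_ //]; exact: subD1set.
  (* A set violating the condition after deletion of [y] from [N x] must contain [x]; [Y] is the
     rest of it. *)
  have wit y : y \in N x -> ~~ hall_condition (D y) -> exists Y,
      x \notin Y /\ #|(\bigcup_(z in Y) N z) :|: (N x :\ y)| <= #|Y|.
    move=> yx /forallPn[X]; rewrite -ltnNge => ltX.
    have DE Z : x \notin Z -> \bigcup_(z in Z) D y z = \bigcup_(z in Z) N z.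
      move=> xZ; apply: eq_bigr => z zZ; rewrite /D; case: eqP => // zx.
      by rewrite -zx zZ in xZ.
    have xX : x \in X.
      by apply/negPn/negP => xX; move: ltX; rewrite DE // ltnNge hN.
    exists (X :\ x); split; first by rewrite !inE eqxx.
    move: ltX; rewrite (big_setD1 x) //= DE ?inE ?eqxx // /D eqxx finset.setUC.
    by rewrite (cardsD1 x X) xX ltnS.
  have [h1|/(wit _ y1x)[Y1 [xY1 le1]]] := boolP (hall_condition (D y1)).
    have [f finj fN] := IH _ (ltD _ y1x) h1.
    by exists f => // z; apply: (fintype.subsetP (sub y1 z)).
  have [h2|/(wit _ y2x)[Y2 [xY2 le2]]] := boolP (hall_condition (D y2)).
    have [f finj fN] := IH _ (ltD _ y2x) h2.
    by exists f => // z; apply: (fintype.subsetP (sub y2 z)).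
  set A1 := _ :|: _ in le1; set A2 := _ :|: _ in le2.
  (* As [y1 != y2], the union of [A1] and [A2] contains all of [N x]. Adding [hU] and [hI] gives
     [#|Y1| + #|Y2| + 1 <= #|A1| + #|A2|], against [le1] and [le2]. *)
  have hU : #|x |: (Y1 :|: Y2)| <= #|A1 :|: A2|.
    apply: leq_trans (hN _) _; apply: subset_leq_card; apply/bigcupsP => z.
    rewrite !inE => /or3P[/eqP->|zY|zY].
    - apply/fintype.subsetP => t tx; rewrite !inE tx.
      case: (eqVneq t y1) => [->|]; last by rewrite !(orbT, andbT).
      by rewrite y12 !orbT.
    - by apply: fintype.subset_trans (finset.bigcup_sup z zY) _;
        rewrite -finset.setUA finset.subsetUl.
    - apply: fintype.subset_trans (finset.bigcup_sup z zY) _.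
      by rewrite /A2 finset.setUCA finset.subsetUl.
  have hI : #|Y1 :&: Y2| <= #|A1 :&: A2|.
    apply: leq_trans (hN _) _; apply: subset_leq_card; apply/bigcupsP => z.
    rewrite !inE => /andP[z1 z2]; rewrite finset.subsetI.
    by rewrite !(fintype.subset_trans _ (finset.subsetUl _ _)) //
      (finset.bigcup_sup z).
  have := cardsUI Y1 Y2; have := cardsUI A1 A2; move: hU hI.
  by rewrite cardsU1 inE negb_or xY1 xY2 /=; lia.
(* Every [N x] is now a singleton, and the condition for pairs makes the choice injective. *)
have Nne x : 0 < #|N x| by have := hN [set x]; rewrite cards1 big_set1.
have /fin_all_exists[f fN] x : exists y, y \in N x by apply/card_gt0P.
exists f => // x1 x2 f12; apply/eqP/negPn/negP => x12.
have NE x : N x = [set f x].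
  apply/esym/eqP; rewrite eqEcard finset.sub1set fN cards1; have := N1 x; lia.
have := hN [set x1; x2]; rewrite cards2 x12 (finset.bigcup_setU) !big_set1 !NE f12.
by rewrite finset.setUid cards1.
Qed.

End Hall.

Section Menger.
Variables (T : finType) (e : rel T) (A B : {set T}).

Definition separates (S : {set T}) := forall a p, a \in A -> path e a p ->
  last a p \in B -> exists2 z, z \in a :: p & z \in S.

(** The matching in [menger] may match a vertex with its own copy; such stationary steps are
    removed. *)
Lemma path_unstutter (r : rel T) a p :
  (forall u v, r u v -> v = u \/ e u v) -> path r a p ->
  exists q, [/\ path e a q, last a q = last a p & {subset a :: q <= a :: p}].
Proof.
move=> re; elim: p a => [|u p IH] a /=; first by move=> _; exists [::]; split.
case/andP=> /re[->|au] /IH[q [q1 q2 q3]].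
  exists q; split=> // z /q3; by rewrite !inE => /orP[->|->]; rewrite ?orbT.
exists (u :: q); split=> //=; first by rewrite au.
by move=> z; rewrite inE => /orP[/eqP->|/q3 zp]; rewrite inE ?eqxx ?zp ?orbT.
Qed.

(* A matching of the out-copies of the vertices outside [B] with the in-copies
   of the vertices outside [A] and [#|A| - k] dummies splits into orbits; at
   most [#|A| - k] of the orbits that start in [A] end at a dummy, and the
   others end in [B].  Unused vertices are matched with themselves. *)
Lemma menger k : [disjoint A & B] ->
  (forall S, separates S -> k <= #|S|) ->
  exists U : 'I_k -> {set T}, (forall i j, i != j -> [disjoint U i & U j]) /\
    forall i, exists a b, [/\ a \in A, b \in B, b \in U i &
      forall v, v \in U i -> exists p,
        [/\ path e a p, last a p = v & {subset a :: p <= U i}]].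
Proof.
move=> dAB hS.
have leA : k <= #|A| by apply: hS => a p aA _ _; exists a; rewrite ?mem_head.
pose d := #|A| - k.
pose L := {u : T | u \notin B}.
pose N (u : L) : {set T + 'I_d} :=
  [set w | if w is inl v then (v \notin A) && ((v == val u) || e (val u) v) else
    true].
have hallN : hall_condition N.
  apply/forallP => X; have [->|/set0Pn[x0 x0X]] := eqVneq X finset.set0;
    first by rewrite cards0.
  pose Y := [set val x | x in X].
  have cY : #|Y| = #|X| by apply: card_imset; exact: val_inj.
  pose NY := [set v | (v \notin A) && [exists u in Y, (v == u) || e u v]].
  (* A path that starts in [A] and avoids this set starts in [Y] and never leaves it, while [Y]
     misses [B]. The resulting lower bound [k] on its size turns into Hall's inequality by
     counting. *)
  have sepS : separates ((NY :\: Y) :|: (A :\: Y)).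
    move=> a p aA ap lB.
    case: (boolP (has (mem ((NY :\: Y) :|: (A :\: Y))) (a :: p))) => [/hasP //|nh].
    suff : last a p \in Y.
      move=> /imsetP[x _ lx]; have := valP x; by rewrite -lx lB.
    have aY : a \in Y.
      move: nh; rewrite /= !inE aA !negb_or => /andP[/andP[_]].
      by rewrite andbT negbK.
    move: nh; rewrite -all_predC /= => /andP[_ nh] {aA lB}.
    elim: p a aY ap nh => [|v p IH] a aY //= /andP[av vp] /andP[nv np].
    apply: (IH v) => //; move: nv; rewrite !inE !negb_or !negb_and !negbK.
    case vY : (v \in Y) => //=; case vA : (v \in A) => //=.
    by rewrite andbT => /existsP[]; exists a; rewrite aY av orbT.
  have := hS _ sepS => leS.
  have leN : #|NY| + d <= #|\bigcup_(x in X) N x|.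
    have -> : #|NY| + d = #|
      [set inl v | v in NY] :|: [set inr i | i : 'I_d] : {set T + 'I_d}|.
      rewrite cardsU disjoint_setI0 ?cards0 ?subn0; last first.
        by rewrite disjoint_subset; apply/fintype.subsetP => _ /imsetP[v _ ->];
          apply/imsetP => -[].
      by rewrite !card_imset ?cardsT ?card_ord // => ? ? [].
    apply: subset_leq_card; apply/fintype.subsetP => w;
      rewrite inE => /orP[/imsetP[v]|/imsetP[i _ ->]].
      rewrite inE => /andP[vA /existsP[u /andP[/imsetP[x xX ->] uv]]] ->.
      by apply/bigcupP; exists x => //; rewrite inE vA.
    by apply/bigcupP; exists x0 => //; rewrite inE.
  have leU : #|(NY :\: Y) :|: (A :\: Y)| <= #|NY :\: Y| + #|A :\: Y|.
    by rewrite cardsU leq_subr.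
  have YA : Y :\: A \subset NY :&: Y.
    apply/fintype.subsetP => v; rewrite !inE => /andP[-> vY]; rewrite vY andbT.
    by apply/existsP; exists v; rewrite vY eqxx.
  have := subset_leq_card YA; have := cardsID Y NY; have := cardsID Y A.
  have := cardsID A Y; rewrite (finset.setIC A) -cY; move: leS leU leN leA;
    rewrite /d; lia.
have [f finj fN] := hall hallN.
(* [None] marks the vertices of [B] and those matched with a dummy: there an orbit ends. *)
pose h (u : T) : option T :=
  if insub u is Some x then (if f x is inl v then Some v else None) else None.
pose r u v := h u == Some v.
have rP u v : r u v -> exists x : L, val x = u /\ f x = inl v.
  rewrite /r /h; case: insubP => // x _ xu; case fx : (f x) => [w|//] /eqP[<-].
  by exists x.
have rinj u u' v : r u v -> r u' v -> u = u'.
  move=> /rP[x [<- fx]] /rP[x' [<- fx']]; congr val; apply: finj; by rewrite fx.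
have re u v : r u v -> v = u \/ e u v.
  move=> /rP[x [<- fx]]; have := fN x; rewrite fx inE => /andP[_ /orP[/eqP|]];
    by auto.
have rA u v : r u v -> v \notin A.
  by move=> /rP[x [_ fx]]; have := fN x; rewrite fx inE => /andP[].
pose U a := [set v | connect r a v].
(* The matching can be followed backwards in only one way and never steps into [A], so orbits that
   meet have the same start. *)
have Uinj a a' v : a \in A -> a' \in A -> v \in U a -> v \in U a' -> a = a'.
  move=> aA aA'; rewrite !inE => /connectP[p + ->] /connectP[p'].
  elim/last_ind: p p' => [|p w IH] p'; case/lastP: p' => [|p' w'] //=.
  - by rewrite rcons_path last_rcons => _ /andP[_ /rA]; move=> + -E; rewrite -E aA.
  - by rewrite rcons_path last_rcons => /andP[_ /rA] + _ E; rewrite E aA'.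
  - rewrite !rcons_path !last_rcons => /andP[ap rw] /andP[ap' rw'] ww'.
    by apply: (IH p') => //; apply: rinj rw _; rewrite ww'.
pose good := [set a in A | ~~ [disjoint U a & B]].
have sink a : a \in A :\: good ->
  exists i : 'I_d, exists2 x : L, val x \in U a & f x = inr i.
  rewrite !inE negb_and => /andP[+ aA]; rewrite aA /= negbK => dUB.
  pose snk := [exists x : L, (val x \in U a) && (if f x is inr _ then true else
    false)].
  case: (boolP snk) => [/existsP[x /andP[xU]]|/existsPn nsnk].
    by case fx : (f x) => [//|i] _; exists i, x.
  have tot v : v \in U a -> exists w, r v w.
    move=> vU; have vB : v \notin B by apply: contraTN vU => vB;
      rewrite (disjointFl dUB vB).
    pose x : L := exist _ v vB; have := nsnk x; rewrite vU /=.
    case fx : (f x) => [w|//] _; exists w; rewrite /r /h.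
    by case: insubP => [y _ yv|]; rewrite ?vB // (_ : y = x) ?fx //; apply: val_inj.
  (* An orbit without a dummy and without a vertex of [B] would be mapped injectively into itself
     minus its start [a]. *)
  pose g v := odflt v (h v).
  have rg v : v \in U a -> r v (g v).
    by move=> /tot[w]; rewrite /r /g => /eqP->.
  have : #|[set g v | v in U a]| <= #|U a :\ a|.
    apply: subset_leq_card; apply/fintype.subsetP => _ /imsetP[v vU ->].
    rewrite in_setD1; apply/andP; split.
      by apply: contraTneq aA => <-; apply: rA (rg v vU).
    by move: (vU); rewrite !inE => av; apply: connect_trans av (connect1 (rg v vU)).
  rewrite card_in_imset; last by move=> u v /rg ru /rg rv guv; apply: rinj ru _;
    rewrite guv.
  by rewrite (cardsD1 a (U a)) inE connect0; lia.
have lebad : #|A :\: good| <= d.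
  pose Q a (i : 'I_d) := [exists x : L, (val x \in U a) && (f x == inr i)].
  pose t a := [pick i | Q a i].
  have tP a : a \in A :\: good -> exists2 i, t a = Some i & Q a i.
    move=> /sink[i [x xU fx]]; rewrite /t; case: pickP => [j Qj|/(_ i)];
      first by exists j.
    by rewrite /Q => /existsP[]; exists x; rewrite xU fx eqxx.
  have tinj : {in A :\: good &, injective t}.
    move=> a a' ab ab' tt; have [i ti /existsP[x /andP[xU /eqP fx]]] := tP _ ab.
    have [j tj /existsP[x' /andP[xU' /eqP fx']]] := tP _ ab'.
    move: tt; rewrite ti tj => -[ij]; move: ab ab';
      rewrite !finset.in_setD => /andP[_ aA] /andP[_ aA'].
    apply: (Uinj _ _ (val x)) => //; suff -> : x = x' by [].
    by apply: finj; rewrite fx fx' ij.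
  rewrite -(card_in_imset tinj) -[leqRHS]card_ord -(card_imset 'I_d (@Some_inj _)).
  apply: subset_leq_card; apply/fintype.subsetP => _ /imsetP[a /tP[i -> _] ->].
  exact: imset_f.
have legood : k <= #|good|.
  have := cardsID good A;
    have : #|A :&: good| <= #|good| by exact: subset_leq_card (subsetIr _ _).
  by move: lebad; rewrite /d; lia.
pose s (i : 'I_k) := enum_val (widen_ord legood i).
have sgood i : s i \in good by exact: enum_valP.
have sA i : s i \in A by have := sgood i; rewrite inE => /andP[].
exists (fun i => U (s i)); split.
  move=> i j ij; rewrite disjoint_subset; apply/fintype.subsetP => v vi;
    apply/negP => /= vj.
  move/negP: ij; apply; apply/eqP;
    have /enum_val_inj := Uinj _ _ _ (sA i) (sA j) vi vj.
  by move=> /(congr1 val) /= ?; apply: val_inj.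
move=> i; have := sgood i; rewrite inE => /andP[_ /pred0Pn[b /andP[/= bU bB]]].
exists (s i), b; split=> // v; rewrite inE => /connectP[p sp ->].
have [q [q1 q2 q3]] := path_unstutter re sp.
exists q; split=> // z /q3 zp; case/splitPl: zp sp {q2 q3} => p1 p2 lz.
by rewrite cat_path inE => /andP[sp1 _]; apply/connectP; exists p1.
Qed.

End Menger.

Local Open Scope classical_set_scope.

(** * Connectivity and distance in graphs *)

Section Connectivity.
Variable G : graph.
Implicit Types (x y z : G) (p : seq G) (D : set G).

Lemma is_walk_rev x p y : is_walk x p y ->
  exists q, [/\ is_walk y q x, size q = size p & {subset y :: q <= x :: p}].
Proof.
move=> [xp <-]; exists (rev (belast x p)); split.
- split.
    rewrite rev_path; apply: sub_path xp => u v /=; by rewrite adj_sym.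
  have := rev_rcons (belast x p) (last x p); rewrite -lastI => /(congr1 (last x)).
  by rewrite /= rev_cons last_rcons => <-.
- by rewrite size_rev size_belast.
- by move=> z; rewrite -rev_rcons -lastI mem_rev.
Qed.

Lemma is_walk_cat x p y q z :
  is_walk x p y -> is_walk y q z -> is_walk x (p ++ q) z.
Proof. by move=> [xp <-] [yq <-]; split; rewrite ?cat_path ?last_cat ?xp. Qed.

(** Both ends have to lie in [D], so that [conn D x x] amounts to [D x]. *)
Definition conn D x y :=
  exists2 p, is_walk x p y & forall z, z \in x :: p -> D z.

Lemma conn_refl D x : D x -> conn D x x.
Proof. by move=> Dx; exists [::] => // z; rewrite inE => /eqP->. Qed.

Lemma conn_edge D x y : D x -> D y -> adj x y -> conn D x y.
Proof.
move=> Dx Dy xy; exists [:: y]; first by split; rewrite /= ?xy.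
by move=> z; rewrite !inE => /orP[]/eqP->.
Qed.

Lemma conn_sym D x y : conn D x y -> conn D y x.
Proof.
move=> [p /is_walk_rev[q [yq _ sub]] Dp]; exists q => // z /sub; exact: Dp.
Qed.

Lemma conn_trans D x y z : conn D x y -> conn D y z -> conn D x z.
Proof.
move=> [p xp Dp] [q yq Dq]; exists (p ++ q); first exact: is_walk_cat xp yq.
move=> w; rewrite -cat_cons mem_cat => /orP[|wq]; first exact: Dp.
by apply: Dq; rewrite inE wq orbT.
Qed.

Lemma conn_sub D D' x y : D `<=` D' -> conn D x y -> conn D' x y.
Proof. by move=> DD' [p xp Dp]; exists p => // z /Dp /DD'. Qed.

Lemma conn_l D x y : conn D x y -> D x.
Proof. by move=> [p _]; apply; rewrite mem_head. Qed.

Lemma conn_r D x y : conn D x y -> D y.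
Proof. by move=> /conn_sym/conn_l. Qed.

(** Induction along a walk inside [D], for invariants that depend only on the current vertex. *)
Lemma conn_inv D (P : G -> Prop) x y : conn D x y -> P x ->
  (forall u v, P u -> D u -> D v -> adj u v -> P v) -> P y.
Proof.
move=> [p]; elim: p x => [|u p IH] x [/= xp lp] Dp Px step; first by rewrite -lp.
case/andP: xp => xu up; apply: (IH u) => //.
- by move=> z zp; apply: Dp; rewrite inE zp orbT.
- by apply: (step x) => //; apply: Dp; rewrite !inE eqxx ?orbT.
Qed.

(** Each vertex of the walk is reached by an initial part of it, hence lies in the component. *)
Lemma conn_component D x y : conn D x y -> conn [set z | conn D x z] x y.
Proof.
move=> xy; have Dx := conn_l xy; apply: (conn_inv xy).
  by apply: conn_refl => /=; exact: conn_refl.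
move=> u v xu Du Dv uv; apply: conn_trans (xu) _; have /= cu := conn_r xu.
by apply: conn_edge => //=; apply: conn_trans cu _; exact: conn_edge.
Qed.

Lemma conn_induced (A : set G) : A !=set0 ->
  (forall x y, A x -> A y -> conn A x y) -> graph_connected (induced A).
Proof.
move=> [a Aa] cA; split.
  by constructor; exact: (exist _ a (mem_set Aa)).
move=> x y; have Ax : A (val x) := set_mem (valP x).
have Ay : A (val y) := set_mem (valP y).
have [p [xp lp] Ap] := cA _ _ Ax Ay.
elim: p x Ax xp lp Ap => [|u p IH] x Ax /= xp lp Ap.
  by exists [::]; split => //; apply: val_inj.
case/andP: xp => xu up.
have Au : A u by apply: Ap; rewrite !inE eqxx orbT.
pose u' : induced A := exist _ u (mem_set Au).
have [|q [q1 q2]] := IH u' Au up lp.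
  by move=> z zp; apply: Ap; rewrite inE zp orbT.
by exists (u' :: q); split => //=; rewrite q1 andbT.
Qed.

Lemma induced_conn (A : set G) x y : graph_connected (induced A) ->
  A x -> A y -> conn A x y.
Proof.
move=> [_ cA] Ax Ay.
pose x' : induced A := exist _ x (mem_set Ax).
have [p [pp lp]] := cA x' (exist _ y (mem_set Ay)).
exists (map val p).
  split; last by rewrite -[x]/(val x') last_map lp.
  by apply: (homo_path (x := x') (e := @adj (induced A))) pp => u v.
move=> z; rewrite inE => /orP[/eqP->//|/mapP[w _ ->]]; exact: set_mem (valP w).
Qed.

End Connectivity.

(** * Graph distance with natural number values *)

Section Distance.
Variables (G : graph) (Gc : forall x y : G, exists p, is_walk x p y).
Implicit Types (x y z : G) (p : seq G).

Fact dist_subproof x y :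
  exists n, `[< exists2 p : seq G, is_walk x p y & size p = n >].
Proof. by have [p xp] := Gc x y; exists (size p); apply/asboolP; exists p. Qed.

(** Counterpart of [gdist] in the natural numbers, available because [Gc] joins any two vertices;
    [gdistE] identifies the two. *)
Definition dist x y : nat := ex_minn (dist_subproof x y).

Lemma distP x y : exists2 p, is_walk x p y & size p = dist x y.
Proof. by rewrite /dist; case: ex_minnP => n /asboolP. Qed.

Lemma dist_le x p y : is_walk x p y -> dist x y <= size p.
Proof.
rewrite /dist; case: ex_minnP => n _ min_n xp.
by apply: min_n; apply/asboolP; exists p.
Qed.

Lemma distxx x : dist x x = 0.
Proof. by apply/eqP; rewrite -leqn0; apply: (@dist_le _ [::]). Qed.

Lemma dist_eq0 x y : dist x y = 0 -> x = y.
Proof. by have [[|z p] [_ <-]] := distP x y => // <-. Qed.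

Lemma dist_sym x y : dist x y = dist y x.
Proof.
suff le u v : dist u v <= dist v u by apply/eqP; rewrite eqn_leq !le.
have [p /is_walk_rev[q [vq sq _]] <-] := distP v u.
by rewrite -sq; exact: dist_le.
Qed.

Lemma dist_triangle y x z : dist x z <= dist x y + dist y z.
Proof.
have [p xp <-] := distP x y; have [q yq <-] := distP y z.
by rewrite -size_cat; apply: dist_le; exact: is_walk_cat xp yq.
Qed.

Lemma dist_adj x y : adj x y -> dist x y <= 1.
Proof. by move=> xy; apply: (@dist_le _ [:: y]); split; rewrite /= ?xy. Qed.

Lemma dist1_adj x y : dist x y = 1 -> adj x y.
Proof.
have [[|u [|v p]] [/= xu lu] sp] := distP x y; rewrite -sp // => _.
by move: xu; rewrite lu andbT.
Qed.

Lemma dist_adjS z x y : adj x y -> dist z y <= (dist z x).+1.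
Proof. move=> /dist_adj xy; have := dist_triangle x z y; lia. Qed.

Lemma geodesicP x y : exists2 p, is_walk x p y &
  forall z, z \in x :: p -> dist x z + dist z y = dist x y.
Proof.
have [p xp sp] := distP x y; exists p => // z zp.
suff: dist x z + dist z y <= dist x y by have := dist_triangle z x y; lia.
rewrite -sp; case: xp => xp <-.
case/splitPl: zp xp => p1 p2 lz; rewrite cat_path last_cat size_cat lz.
move=> /andP[xp1 zp2]; apply: leq_add; apply: dist_le; split=> //.
Qed.

(** Describes a geodesic by a metric condition, so that the triangle inequality can keep it inside
    or outside a given set. *)
Lemma conn_geodesic x y :
  conn [set z | dist x z + dist z y = dist x y] x y.
Proof. by have [p xp pP] := geodesicP x y; exists p. Qed.

Lemma geodesic_point x y i : i <= dist x y ->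
  exists2 z, dist x z = i & dist z y = dist x y - i.
Proof.
have [p xp sp] := distP x y; rewrite -sp => lei.
have zp : last x (take i p) \in x :: p.
  by have := mem_last x (take i p); rewrite !inE => /orP[->//|/mem_take->];
    rewrite orbT.
case: (xp) => [pp lp]; pose z := last x (take i p).
have e1 : dist x z <= i.
  have -> : i = size (take i p) by rewrite size_takel.
  apply: dist_le; split=> //; move: pp; rewrite -{1}(cat_take_drop i p) cat_path.
  by case/andP.
have e2 : dist z y <= size p - i.
  rewrite -size_drop; apply: dist_le; move: pp lp.
  rewrite -{1 2}(cat_take_drop i p) cat_path last_cat => /andP[_ ? ?]; by split.
have := dist_triangle z x y; rewrite -sp => e3.
by exists z; lia.
Qed.

Lemma conn_ball x n y z : dist x y <= n -> dist x z <= n ->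
  conn [set w | dist x w <= n] y z.
Proof.
suff c u : dist x u <= n -> conn [set w | dist x w <= n] x u.
  by move=> /c/conn_sym cy /c; exact: conn_trans.
move=> xu; apply: conn_sub (conn_geodesic x u) => w /=; lia.
Qed.

Lemma ball_finite x n : locally_finite G ->
  exists s : seq G, forall z, (z \in s) = (dist x z <= n).
Proof.
move=> lf; suff [s sP] : exists s : seq G, forall z, dist x z <= n -> z \in s.
  exists [seq z <- s | dist x z <= n] => z; rewrite mem_filter.
  by case: leqP => //= /sP.
have {lf}/choice[N NP] : forall y : G, exists s : seq G, forall z, adj y z ->
  z \in s.
  by move=> y; have /finite_seqP[s sE] := lf y; exists s => z yz;
    have : [set` s] z by rewrite -sE.
elim: n => [|n [s sP]].
  by exists [:: x] => z; rewrite leqn0 => /eqP/dist_eq0->; rewrite inE.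
exists (s ++ flatten (map N s)) => z zn; rewrite mem_cat.
case: (leqP (dist x z) n) => [/sP->//|zn'].
have [w xw wz] := geodesic_point (ltnW zn').
apply/orP; right; apply/flattenP; exists (N w); first by apply: map_f; apply: sP;
  lia.
by apply: NP; apply: dist1_adj; lia.
Qed.

End Distance.

(** Typically applied to a list of orbit representatives, after which automorphisms carry the bound
    to all vertices. *)
Lemma uniform_bound (T : eqType) (s : seq T) (P : T -> nat -> Prop) :
  (forall x, exists n, P x n) -> (forall x n m, n <= m -> P x n -> P x m) ->
  exists n, forall x, x \in s -> P x n.
Proof.
move=> eP mP; elim: s => [|a s [n nP]]; first by exists 0.
have [m Pm] := eP a; exists (maxn m n) => x; rewrite inE => /orP[/eqP->|/nP].
  by apply: mP Pm; exact: leq_maxl.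
by apply: mP; exact: leq_maxr.
Qed.

(** * Automorphisms and orbit representatives *)

Section Automorphisms.
Variable G : graph.
Implicit Types (x y : G) (f g : G -> G).

Lemma automorphism_id : is_automorphism (@id G).
Proof. by split=> //; exists id. Qed.

Lemma automorphism_inv f : is_automorphism f ->
  exists g, [/\ is_automorphism g, cancel f g & cancel g f].
Proof.
move=> [[g fg gf] fadj]; exists g; split=> //; split; first by exists f.
by move=> x y; rewrite -fadj !gf.
Qed.

Lemma walk_automorphism f x p y : is_automorphism f ->
  is_walk x p y -> is_walk (f x) (map f p) (f y).
Proof.
move=> [_ fadj] [xp <-]; split; last by rewrite last_map.
by rewrite path_map; apply: sub_path xp => u v /=; rewrite fadj.
Qed.

Lemma conn_automorphism f g (D : set G) x y : is_automorphism g -> cancel g f ->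
  conn D x y -> conn (f @^-1` D) (g x) (g y).
Proof.
move=> gP gf [p xp Dp]; exists (map g p); first exact: walk_automorphism.
move=> z; rewrite -map_cons => /mapP[w wp ->]; by rewrite /= gf; exact: Dp.
Qed.

Lemma quasi_transitive_reps : quasi_transitive G -> exists s : seq G,
  forall u, exists v f, [/\ v \in s, is_automorphism f & f v = u].
Proof.
move=> /finite_seqP[os osE].
have [s sP] : exists s : seq G, forall u, aut_orbit u \in os ->
    exists2 v, v \in s & aut_orbit v = aut_orbit u.
  elim: os {osE} => [|O os [s sP]]; first by exists [::].
  (* The induction runs over arbitrary lists of sets, so the head need not be an orbit. *)
  have [[w wO]|nO] := pselect (exists w, aut_orbit w = O).
    exists (w :: s) => u; rewrite inE => /orP[/eqP uO|/sP[v vs vu]].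
      by exists w; rewrite ?mem_head // wO uO.
    by exists v => //; rewrite inE vs orbT.
  exists s => u; rewrite inE => /orP[/eqP uO|/sP//].
  by case: nO; exists u.
exists s => u; have [|v vs vu] := sP u.
  suff : [set` os] (aut_orbit u) by [].
  by rewrite -osE; exists u.
have : aut_orbit v u by rewrite vu; exists id => //; exact: automorphism_id.
by move=> [f fP fv]; exists v, f.
Qed.

Lemma reps_quasi_transitive (s : seq G) :
  (forall u, exists v f, [/\ v \in s, is_automorphism f & f v = u]) ->
  quasi_transitive G.
Proof.
move=> sP; apply: (sub_finite_set (B := [set` map (@aut_orbit G) s])); last first.
  exact: finite_seq.
move=> _ [u _ <-]; have [v [f [vs fP fv]]] := sP u; apply/mapP; exists v => //.
have [g [gP fg gf]] := automorphism_inv fP.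
apply/seteqP; split=> w [h [hb hadj] hw].
  exists (h \o f); last by rewrite /= fv.
  by case: fP => fb fadj; split; [exact: bij_comp|move=> a b; rewrite /= hadj fadj].
exists (h \o g); last by rewrite /= -fv fg.
by case: gP => gb gadj; split; [exact: bij_comp|move=> a b; rewrite /= hadj gadj].
Qed.

Variable Gc : forall x y : G, exists p, is_walk x p y.

Lemma dist_automorphism f x y : is_automorphism f ->
  dist Gc (f x) (f y) = dist Gc x y.
Proof.
have le h u v : is_automorphism h -> dist Gc (h u) (h v) <= dist Gc u v.
  move=> hP; have [p xp <-] := distP Gc u v; rewrite -(size_map h).
  by apply: dist_le; exact: walk_automorphism.
move=> fP; have [g [gP fg _]] := automorphism_inv fP.
by apply/eqP; rewrite eqn_leq le //= -{1}[x]fg -{1}[y]fg le.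
Qed.

End Automorphisms.

(** * Quasi-isometries in terms of natural number distances *)

Section ExtendedDistance.
Variable R : realType.

Lemma gdist_walk (G : graph) (x y : G) :
  (gdist R x y < +oo)%E -> exists p, is_walk x p y.
Proof.
by move=> /ereal_inf_lt[_ [p xp _] _]; exists p.
Qed.

Lemma gdistE (G : graph) (Gc : forall x y : G, exists p, is_walk x p y) x y :
  gdist R x y = (dist Gc x y)%:R%:E.
Proof.
apply/eqP; rewrite eq_le; apply/andP; split.
  apply: ereal_inf_lbound; have [p xp <-] := distP Gc x y; by exists p.
apply: le_ereal_inf_tmp => _ [p xp <-]; rewrite lee_fin ler_nat; exact: dist_le.
Qed.

(** [gdist] is infinite between vertices that no walk joins, whereas the quasi-isometry bounds it by
    a finite quantity. *)
Lemma quasi_isometry_connected (G H : graph) (f : G -> H) :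
  is_quasi_isometry R f -> (forall x y : H, exists p, is_walk x p y) ->
  forall x y : G, exists p, is_walk x p y.
Proof.
move=> [g [c [_ _ fP _]]] Hc x y; apply: gdist_walk.
have [_] := fP x y; rewrite (gdistE Hc) -EFinM -EFinD => /le_lt_trans; apply.
exact: ltry.
Qed.

Lemma quasi_isometry_dist (G H : graph) (f : G -> H)
    (Gc : forall x y : G, exists p, is_walk x p y)
    (Hc : forall x y : H, exists p, is_walk x p y) :
  is_quasi_isometry R f -> exists C, forall x y,
    dist Hc (f x) (f y) <= C * dist Gc x y + C /\
    dist Gc x y <= C * dist Hc (f x) (f y) + C.
Proof.
move=> [g [c [g1 c0 fP _]]].
(* [C] dominates the factor [g] and both additive terms: [c], and the [g * c] that arises when the
   lower bound is multiplied by [g]. *)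
have [C CP] : exists C : nat, (g * c + g + c < C%:R)%R.
  by eexists; exact: truncnS_gt.
exists C => x y.
have [] := fP x y; rewrite (gdistE Gc) (gdistE Hc).
rewrite -!EFinM -EFinN -!EFinD !lee_fin -!(ler_nat R) !natrD !natrM.
set a : R := (dist Hc _ _)%:R%R; set b : R := (dist Gc _ _)%:R%R => h1 h2.
move: (C%:R)%R CP => K CP.
have a0 : (0 <= a)%R by exact: ler0n.
have b0 : (0 <= b)%R by exact: ler0n.
have g0 : (0 < g)%R by lra.
have h3 : (a <= g * (b + c))%R.
  by rewrite -ler_pdivrMl //; lra.
have gc0 : (0 <= g * c)%R by apply: mulr_ge0; lra.
have gbC : (g * b <= K * b)%R by apply: ler_wpM2r => //; lra.
have gaC : (g * a <= K * a)%R by apply: ler_wpM2r => //; lra.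
by split; [rewrite mulrDr in h3|]; lra.
Qed.

Lemma quasi_isometry_of_dist (G H : graph) (f : G -> H)
    (Gc : forall x y : G, exists p, is_walk x p y)
    (Hc : forall x y : H, exists p, is_walk x p y) (c : nat) :
  (forall x y, dist Hc (f x) (f y) <= dist Gc x y + c) ->
  (forall x y, dist Gc x y <= dist Hc (f x) (f y) + c) ->
  (forall z, exists x, f x = z) -> is_quasi_isometry R f.
Proof.
move=> h1 h2 surj; exists 1%R, c%:R%R; split; [exact: lexx|exact: ler0n| |].
  move=> x y; rewrite (gdistE Gc) (gdistE Hc) invr1 mul1e -EFinN -!EFinD !lee_fin.
  by rewrite lerBlDr -!natrD !ler_nat.
move=> z; have [x <-] := surj z; exists x.
by rewrite (gdistE Hc) distxx lee_fin ler0n.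
Qed.

End ExtendedDistance.

(** * Tight separators *)

Section TightSeparators.
Variable G : graph.

(** A minimal separator of two components, relative to a region [D]. The region allows vertices to
    be deleted in an induction and a large ball to stand in for the graph. *)
Definition tight (D : set G) (S : seq G) :=
  (forall s, s \in S -> D s) /\ exists c1 c2, let E := D `\` [set` S] in
    ~ conn E c1 c2 /\ forall s, s \in S ->
      (exists2 u, adj s u & conn E c1 u) /\ (exists2 u, adj s u & conn E c2 u).

(* Only finitely many tight separators of bounded size contain a given vertex
   [v]: such a separator meets any fixed path joining two neighbours of [v]
   around [v], and it stays tight after deletion of [v]. The region [W] is
   arbitrary as long as it contains the finitely many paths involved. *)
Lemma tight_finite (k : nat) (X : seq G) (v : G) : locally_finite G ->
  exists F : seq G, forall (W : set G) (S : seq G), (forall z, z \in F -> W z) ->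
    size S <= k -> v \in S -> tight (W `\` [set` X]) S -> {subset S <= F}.
Proof.
move=> lf; elim: k X v => [|k IH] X v.
  by exists [::] => W [].
have [nb nbE] := (finite_seqP _).1 (lf v).
have nbP u : adj v u -> u \in nb by move=> vu; suff : [set` nb] u by [];
  rewrite -nbE.
(* For every pair of vertices that can be joined around [v] and [X], one such path is fixed. *)
have /choice[P PP] : forall uw : G * G, exists p : seq G,
    conn (~` [set` v :: X]) uw.1 uw.2 ->
    is_walk uw.1 p uw.2 /\ forall z, z \in uw.1 :: p -> z \notin v :: X.
  move=> uw; have [[p wp Dp]|] := pselect (conn (~` [set` v :: X]) uw.1 uw.2).
    by exists p => _; split=> // z /Dp /= /negP.
  by exists [::].
have /choice[F0 F0P] := IH (v :: X).
pose paths := flatten [seq uw.1 :: P uw | uw <- [seq (u, w) | u <- nb, w <- nb]].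
(* The list consists of [v], the fixed paths between neighbours of [v], and what the induction
   hypothesis, with [v] deleted, yields for each vertex of these paths. *)
exists (v :: paths ++ flatten (map F0 paths)) => W S FW sS vS.
move=> [SD [c1 [c2 []]]]; set E := _ `\` _ => nc adjS.
have [[u1 vu1 cu1] [u2 vu2 cu2]] := adjS v vS.
pose S' := [seq z <- S | predC1 v z].
have sS' : size S' <= k.
  rewrite size_filter -ltnS; apply: leq_trans sS.
  rewrite -(count_predC (predC1 v) S) -addn1 leq_add2l -has_count.
  by apply/hasP; exists v => //=; rewrite eqxx.
(* Moving [v] from the separator to the deleted vertices does not change the complement. *)
have EE : E = (W `\` [set` v :: X]) `\` [set` S'].
  apply/seteqP; split=> z /=; rewrite mem_filter inE /=.
    move=> [[Wz zX] zS]; split; last by move=> /andP[].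
    split=> // /orP[/eqP zv|//]; by apply: zS; rewrite zv.
  move=> [[Wz /negP]]; rewrite negb_or => /andP[zv zX] /negP.
  by rewrite zv /= => zS; split; [split=> //; exact/negP|exact/negP].
have SF : S' = [::] \/ {subset S' <= paths ++ flatten (map F0 paths)}.
  case S'E : S' => [|s S'']; [by left|right; rewrite -S'E].
  have sS'' : s \in S' by rewrite S'E mem_head.
  have /andP[/= sv sS2] : predC1 v s && (s \in S) by rewrite -mem_filter.
  have [[w1 sw1 cw1] [w2 sw2 cw2]] := adjS s sS2.
  have Ev : E `<=` ~` [set` v :: X].
    by rewrite EE => z [[]].
  have sN : (~` [set` v :: X]) s.
    move=> /=; rewrite inE (negbTE sv) /= => sX.
    by have [_] := SD s sS2.
  (* The detour from [u1] to [u2] leads through the first component to [w1], across [s], and on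
     through the second component from [w2]; it avoids [v]. *)
  have c12 : conn (~` [set` v :: X]) u1 u2.
    apply: (conn_trans (y := w1)).
      by apply: (conn_sub Ev); apply: conn_trans (conn_sym cu1) cw1.
    apply: (conn_trans (y := s)).
      by apply: conn_edge; rewrite // 1?adj_sym //; apply: Ev; apply: conn_r cw1.
    apply: (conn_trans (y := w2)).
      by apply: conn_edge => //; apply: Ev; apply: conn_r cw2.
    by apply: (conn_sub Ev); apply: conn_trans (conn_sym cw2) cu2.
  have [wP nP] := PP (u1, u2) c12.
  have sub : {subset u1 :: P (u1, u2) <= paths}.
    move=> z zP; apply/flattenP; exists (u1 :: P (u1, u2)) => //.
    by apply/mapP; exists (u1, u2) => //; apply/allpairsP; exists (u1, u2);
      split=> //; exact: nbP.
  (* Otherwise the fixed path would join [c1] to [c2] in [E]. *)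
  have [w wP1 wS] : exists2 w, w \in u1 :: P (u1, u2) & w \in S'.
    apply/hasP/negPn/negP => nh; apply: nc; apply: conn_trans cu1 _.
    apply: conn_trans (conn_sym cu2); exists (P (u1, u2)) => // z zP.
    rewrite EE; split; first split.
    - by apply: FW; rewrite inE mem_cat sub ?orbT.
    - exact/negP/nP.
    - by move=> zS; move/hasP: nh; apply; exists z.
  have := F0P w W S' _ sS' wS; move=> F0w z zS'; rewrite mem_cat; apply/orP; right.
  apply/flattenP; exists (F0 w); first exact/map_f/sub.
  apply: F0w zS' => [y yF|].
    apply: FW; rewrite inE mem_cat; apply/orP; right; apply/orP; right.
    by apply/flattenP; exists (F0 w) => //; exact/map_f/sub.
  split.
    move=> y; rewrite mem_filter => /andP[/= yv yS]; have [Wy yX] := SD y yS.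
    by split=> //=; rewrite inE (negbTE yv).
  exists c1, c2; rewrite /= -EE; split=> // y; rewrite mem_filter => /andP[_];
    exact: adjS.
move=> z zS; rewrite inE; case: eqVneq => //= zv.
have zS' : z \in S' by rewrite mem_filter /= zv.
by case: SF => [S0|]; [rewrite S0 in zS'|apply].
Qed.

Variable Gc : forall x y : G, exists p, is_walk x p y.

(** [tight_finite] gives a radius for each orbit representative; the maximum works everywhere, since
    automorphisms preserve tightness and distances. *)
Lemma tight_bounded (k : nat) : locally_finite G -> quasi_transitive G ->
  exists r, forall (v : G) (W : set G) (S : seq G),
    (forall z, dist Gc v z <= r -> W z) -> size S <= k -> v \in S -> tight W S ->
    forall s, s \in S -> dist Gc v s <= r.
Proof.
move=> lf /quasi_transitive_reps[reps repsP].
pose P v r := forall (W : set G) (S : seq G),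
    (forall z, dist Gc v z <= r -> W z) -> size S <= k -> v \in S -> tight W S ->
    forall s, s \in S -> dist Gc v s <= r.
have [||r rP] := @uniform_bound G reps P.
- move=> v; have [F FP] := tight_finite k [::] v lf.
  exists (\max_(z <- F) dist Gc v z) => W S WP sS vS tS s sS2.
  apply: (leq_bigmax_seq (F := dist Gc v)) => //; apply: (FP W S) => //.
    by move=> z zF; apply: WP; apply: (leq_bigmax_seq (F := dist Gc v)).
  by rewrite set_nil setD0.
- move=> v n m nm Pn W S WP sS vS tS s sS2; apply: leq_trans (nm).
  by apply: (Pn W S) => // z zn; apply: WP; exact: leq_trans zn nm.
exists r => v W S WP sS vS [SW [c1 [c2 [nc adjS]]]] s sS2.
have [v0 [f [v0r fP fv0]]] := repsP v; have [g [gP fg gf]] := automorphism_inv fP.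
have := rP v0 v0r (f @^-1` W) (map g S).
have gv : g v = v0 by rewrite -fv0 fg.
have gS z : (z \in map g S) = (f z \in S).
  by rewrite -{1}[z]fg mem_map //; exact: can_inj gf.
move=> H; rewrite -(dist_automorphism Gc v s gP) gv; apply: H.
- by move=> z zr /=; apply: WP; rewrite -fv0 dist_automorphism.
- by rewrite size_map.
- by rewrite gS fv0.
- split; first by move=> z; rewrite gS => /SW.
  have EE : (f @^-1` W) `\` [set` map g S] = f @^-1` (W `\` [set` S]).
    by apply/seteqP; split=> z /=; rewrite gS.
  exists (g c1), (g c2); rewrite /= EE; split.
    move=> /(conn_automorphism fP fg); rewrite !gf => c12; apply: nc.
    by apply: conn_sub c12 => z /=; rewrite gf.
  move=> z; rewrite gS => /adjS[[u1 a1 k1] [u2 a2 k2]]; split.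
    exists (g u1); first by rewrite -(proj2 fP) gf.
    exact: conn_automorphism.
  exists (g u2); first by rewrite -(proj2 fP) gf.
  exact: conn_automorphism.
- by rewrite gS gf.
Qed.

End TightSeparators.

(** * Graphs quasi-isometric to trees *)

Section Trees.
Variables (T : graph) (treeT : is_tree T).
Let Tc := (treeT.1).2.

(** A walk from [a] to [b] avoiding [t] shortens to a path that closes up through [t] to a cycle. *)
Lemma tree_neighbors (t a b : T) : adj t a -> adj t b -> a != b ->
  ~ conn (~` [set t]) a b.
Proof.
move=> ta tb ab [p [ap lp] tp]; have {}tp : t \notin a :: p by apply/negP => /tp;
  apply.
case: (shortenP ap) lp => q aq uq sub lq.
have tq : t \notin a :: q.
  move: tp; rewrite !inE !negb_or => /andP[->]; apply: contraNN; exact: sub.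
case: treeT => _ /(_ (t :: a :: q)); apply.
  by case: q lq {aq uq sub tq} => //= /eqP; rewrite (negbTE ab).
by rewrite /ucycle /= ta rcons_path aq lq adj_sym tb /= tq.
Qed.

(* Among the points of the [A i] closest to a root, the one farthest from the
   root lies in every [A j]. *)
Lemma tree_helly (n : nat) (A : 'I_n.+1 -> set T) :
  (forall i x y, A i x -> A i y -> conn (A i) x y) ->
  (forall i j, A i `&` A j !=set0) -> exists t, forall i, A i t.
Proof.
move=> cA iA; case: treeT => -[[o] _] _; pose d := dist Tc o.
have /choice[top topP] : forall i, exists t, A i t /\ forall x, A i x -> d t <= d x.
  move=> i; have ex : exists m, `[< exists2 t, A i t & d t = m >].
    by have [x [Ax _]] := iA i i; exists (d x); apply/asboolP; exists x.
  case: (ex_minnP ex) => m /asboolP[t At dt] min_m; exists t; split=> // x Ax.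
  by rewrite dt; apply: min_m; apply/asboolP; exists x.
case: (@arg_maxnP _ ord0 xpredT (fun i => d (top i))) => // i _ imax.
have [] := topP i; set t := top i in imax * => At tmin.
(* Being the vertex of [A i] closest to the root, [t] separates the rest of [A i] from the root. *)
have sep w : A i w -> ~ conn (~` [set t]) w o.
  move=> Aw; apply: (conn_inv (P :=
    fun u => ~ conn (~` [set t]) u o) (cA _ _ _ At Aw)); first by move=> /conn_l;
    apply.
  move=> u v nu Au Av uv cv; have vt : v <> t := conn_l cv.
  have ot : o <> t := conn_r cv.
  have [ut|ut] := pselect (u = t); last first.
    by apply: nu; apply: conn_trans cv; apply: conn_edge.
  have dt : 0 < d t.
    by rewrite lt0n; apply/eqP => /dist_eq0.
  (* [b] is the neighbour of [t] towards the root; it differs from [v], which is not closer to the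
     root than [t]. *)
  have [b db bt] := geodesic_point (leq_pred (d t)).
  have tb : adj t b.
    by rewrite adj_sym; apply: (dist1_adj (Gc := Tc)); rewrite bt -/(d t); lia.
  have dv := tmin v Av.
  apply: (@tree_neighbors t v b) => //; first by rewrite -ut.
    by apply/eqP => vb; rewrite vb in dv; move: dv db dt; rewrite /d; lia.
  apply: conn_trans cv _; apply: conn_sub (conn_geodesic Tc o b) => z /= zb zt.
  by move: zb; rewrite zt db -/(d t); lia.
exists t => j; apply: contrapT => nAt.
have [w [wi wj]] := iA i j; have [Aj _] := topP j.
(* If [A j] missed [t], then [w] could reach the root around [t]: inside [A j] to [top j], which is
   no farther from the root than [t], and then along a geodesic. *)
apply: (sep w wi); apply: (@conn_trans _ _ _ (top j)).
  by apply: conn_sub (cA _ _ _ wj Aj) => z Az /= zt; apply: nAt; rewrite -zt.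
apply: conn_sym; apply: conn_sub (conn_geodesic Tc o (top j)) => z /= zj zt.
have := imax j isT; rewrite /= => le_j; apply: nAt.
suff -> : t = top j by [].
by apply: (dist_eq0 (Gc := Tc)); move: zj le_j; rewrite zt /d; lia.
Qed.

End Trees.

Definition complete_adj (V : eqType) : rel V := fun x y => x != y.

Fact complete_adj_sym (V : eqType) : symmetric (@complete_adj V).
Proof. by move=> x y; rewrite /complete_adj eq_sym. Qed.

Fact complete_adj_irrefl (V : eqType) : irreflexive (@complete_adj V).
Proof. by move=> x; rewrite /complete_adj eqxx. Qed.

Definition complete_graph (V : choiceType) : graph :=
  Graph (@complete_adj_sym V) (@complete_adj_irrefl V).

Lemma ball_size_bounded (H : graph) (Hc : forall x y : H, exists p, is_walk x p y)
    (r : nat) : locally_finite H -> quasi_transitive H ->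
  exists M, forall (v : H) (s : seq H), uniq s ->
    (forall z, z \in s -> dist Hc v z <= r) -> size s <= M.
Proof.
move=> lf /quasi_transitive_reps[reps repsP].
pose P (v : H) M := forall s : seq H, uniq s ->
    (forall z, z \in s -> dist Hc v z <= r) -> size s <= M.
have [||M MP] := @uniform_bound H reps P.
- move=> v; have [b bP] := ball_finite Hc v r lf; exists (size b) => s us sP.
  by apply: uniq_leq_size => // z /sP; rewrite bP.
- by move=> v n m nm Pn s us sP; apply: leq_trans (Pn s us sP) nm.
exists M => v s us sP; have [v0 [f [v0r fP fv]]] := repsP v.
have [g [gP fg gf]] := automorphism_inv fP.
rewrite -(size_map g); apply: (MP v0) => //.
  by rewrite map_inj_uniq //; exact: can_inj gf.
by move=> _ /mapP[z /sP zr ->]; rewrite -[v0]fg fv dist_automorphism.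
Qed.

Lemma tree_like_minor_excluded (H T : graph) (f : H -> T) (treeT : is_tree T)
    (Hc : forall x y : H, exists p, is_walk x p y)
    (Tc : forall x y : T, exists p, is_walk x p y) (C : nat) :
  locally_finite H -> quasi_transitive H ->
  (forall x y, dist Tc (f x) (f y) <= C * dist Hc x y + C /\
               dist Hc x y <= C * dist Tc (f x) (f y) + C) ->
  minor_excluded H.
Proof.
(* [l] bounds the distance between images of adjacent vertices; [r] bounds the distance between
   vertices whose images are within [l] of a common vertex. *)
move=> lf qt fP; pose l := C + C; pose r := C * (l + l) + C.
have [M MP] := ball_size_bounded Hc r lf qt.
exists (complete_graph 'I_M.+1); first exact: finite_finset.
move=> [B [B0 trivB cB adjB]].
pose A (i : 'I_M.+1) := [set t | exists2 v, B i v & dist Tc t (f v) <= l].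
have fl u v : adj u v -> dist Tc (f u) (f v) <= l.
  by move=> /(dist_adj Hc) uv; have [] := fP u v; rewrite /l; nia.
have bA i u t : B i u -> dist Tc (f u) t <= l -> A i t.
  by move=> Bu ut; exists u; rewrite // dist_sym.
have cball i u t : B i u -> dist Tc (f u) t <= l -> conn (A i) (f u) t.
  move=> Bu ut; apply: conn_sub (conn_ball (n := l) _ ut) => [z /=|];
    first exact: bA.
  by rewrite distxx.
have [||t tP] := @tree_helly T treeT M A.
- move=> i x y [u Bu xu] [v Bv yv].
  apply: (@conn_trans _ _ _ (f u)).
    by apply: conn_sym; apply: cball; rewrite // dist_sym.
  apply: (@conn_trans _ _ _ (f v)); last by apply: cball; rewrite // dist_sym.
  apply: (conn_inv (P :=
    fun w => conn (A i) (f u) (f w)) (induced_conn (cB i) Bu Bv)).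
    by apply: conn_refl; apply: (bA i u); rewrite // distxx.
  move=> w w' cw Bw Bw' ww'; apply: conn_trans cw _; apply: cball => //; exact: fl.
- move=> i j; have [<-|ij] := eqVneq i j.
    have [u Bu] := B0 i; exists (f u).
    by split; apply: (bA i u); rewrite // distxx.
  have [u [v [Bu Bv uv]]] := adjB i j ij; exists (f v).
  by split; [apply: (bA i u) => //; exact: fl|apply: (bA j v); rewrite // distxx].
(* One vertex from each of the [M.+1] disjoint branch sets: they are distinct and lie in one ball of
   radius [r], which has at most [M] vertices. *)
have /choice[v vP] : forall i : 'I_M.+1, exists v, B i v /\ dist Tc t (f v) <= l.
  by move=> i; have [v] := tP i; exists v.
have vinj : injective v.
  move=> i j vij; apply: trivB => //; exists (v i); split; first by case: (vP i).
  by rewrite vij; case: (vP j).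
suff : size (codom v) <= M by rewrite size_codom card_ord ltnn.
apply: (MP (v ord0)).
  by rewrite /codom map_inj_uniq ?enum_uniq.
move=> _ /codomP[i ->]; have [_ l0] := vP ord0; have [_ li] := vP i.
have [_ le_v] := fP (v ord0) (v i).
have := dist_triangle Tc t (f (v ord0)) (f (v i)); rewrite (dist_sym _ _ t) => tri.
apply: leq_trans le_v _; rewrite /r leq_add2r leq_mul2l; apply/orP; right; lia.
Qed.

(** * The tree of components of complements of balls *)

Section LevelTree.
Variables (G : graph) (Gc : forall x y : G, exists p, is_walk x p y) (o : G).
Implicit Types x y z : G.

Definition level x := dist Gc o x.

Definition level_conn x y :=
  level x = level y /\ conn [set z | level x <= level z] x y.

(** The set contains [x], so [xget] does return one of its members; equivalent vertices have equal
    sets and therefore the same representative. *)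
Definition level_rep x := xget o [set y | level_conn x y].

(* The nodes are the components of the sets [level >= k], each represented by
   one of its vertices at level [k]. *)
Definition level_node := set_type (range level_rep).

Definition node_level (u : level_node) := level (val u).

Definition level_proj x : level_node :=
  exist _ (level_rep x) (mem_set (imageT level_rep x)).

Definition level_adj : rel level_node := fun u v =>
  `[< u != v /\ exists x y, [/\ adj x y, level_proj x = u & level_proj y = v] >].

Fact level_adj_sym : symmetric level_adj.
Proof.
move=> u v; apply: asbool_equiv_eq.
by split=> -[uv [x [y [xy xu yv]]]]; rewrite eq_sym uv; split=> //; exists y, x;
  rewrite adj_sym.
Qed.

Fact level_adj_irrefl : irreflexive level_adj.
Proof. by move=> u; apply/asboolP => -[]; rewrite eqxx. Qed.

Definition level_tree : graph := Graph level_adj_sym level_adj_irrefl.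

Lemma level_conn_refl x : level_conn x x.
Proof. by split=> //; apply: conn_refl => /=. Qed.

Lemma level_conn_sym x y : level_conn x y -> level_conn y x.
Proof. by move=> [e c]; split=> //; rewrite -e; exact: conn_sym. Qed.

Lemma level_conn_trans y x z :
  level_conn x y -> level_conn y z -> level_conn x z.
Proof.
move=> [e c] [e' c']; split; first by rewrite e.
by apply: conn_trans c _; rewrite e.
Qed.

Lemma level_repP x : level_conn x (level_rep x).
Proof. exact: (xgetPex o (ex_intro _ x (level_conn_refl x))). Qed.

Lemma level_projP x y : level_proj x = level_proj y <-> level_conn x y.
Proof.
split=> [/(congr1 val) /= e|xy].
  apply: level_conn_trans (level_repP x) _; rewrite e.
  exact/level_conn_sym/level_repP.
apply: val_inj => /=; congr xget; apply/seteqP; split=> z /=.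
  exact/level_conn_trans/level_conn_sym.
exact: level_conn_trans.
Qed.

Lemma level_projK (u : level_node) : level_proj (val u) = u.
Proof.
case: u => v /= vP; have [x _ xv] := set_mem vP; apply: val_inj => /=.
have /level_projP/(congr1 val)/= := level_repP x; by rewrite -xv.
Qed.

Lemma level_proj_val x : level_conn x (val (level_proj x)).
Proof. exact: level_repP. Qed.

Lemma level_adj_proj x y : adj x y ->
  level_proj x = level_proj y \/ level_adj (level_proj x) (level_proj y).
Proof.
move=> xy; have [->|ne] := eqVneq (level_proj x) (level_proj y); first by left.
by right; apply/asboolP; split=> //; exists x, y.
Qed.

(** An edge between two vertices of equal level keeps them in one node, so every edge of the tree
    changes the level by exactly one. *)
Lemma level_adjP (u v : level_node) : level_adj u v -> exists x y,
  [/\ adj x y, level_conn (val u) x, level_conn (val v) y &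
      [/\ node_level u = level x, node_level v = level y &
          level x = (level y).+1 \/ level y = (level x).+1]].
Proof.
move=> /asboolP[uv [x [y [xy xu yv]]]]; exists x, y.
have ux : level_conn (val u) x by rewrite -xu; exact/level_conn_sym/level_proj_val.
have vy : level_conn (val v) y by rewrite -yv; exact/level_conn_sym/level_proj_val.
split=> //; split; [by case: ux|by case: vy|].
- have := dist_adjS Gc o xy; rewrite adj_sym in xy.
  have := dist_adjS Gc o xy; rewrite -/(level x) -/(level y).
  have [exy|] := eqVneq (level x) (level y); last by lia.
  case/eqP: uv; rewrite -xu -yv; apply/level_projP; split=> //.
  by apply: conn_edge; rewrite //= ?exy // adj_sym.
Qed.

(** Uniqueness of the parent: the upper ends of both edges lie in one component at the level of [u],
    which joins the lower ends without going below their level. *)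
Lemma level_lower_unique (u v w : level_node) : level_adj u v -> level_adj u w ->
  node_level v < node_level u -> node_level w < node_level u -> v = w.
Proof.
move=> /level_adjP[x [y [xy ux vy [e1 e3 xy1]]]] /level_adjP[x' [y' [xy' ux' wy'
  [e2 e4 xy1']]]] vu wu.
rewrite -(level_projK v) -(level_projK w); apply/level_projP.
apply: level_conn_trans (vy) _; apply: level_conn_trans (level_conn_sym (wy')).
split; first lia.
have xx' : conn [set z | level y <= level z] x x'.
  have [_ c] := level_conn_trans (level_conn_sym ux) ux'.
  by apply: conn_sub c => z /=; lia.
apply: (@conn_trans _ _ _ x); first by apply: conn_edge => /=;
  [lia|lia|rewrite adj_sym].
apply: conn_trans xx' _; apply: conn_edge => //=; lia.
Qed.

Lemma level_walk x p y : is_walk x p y -> exists2 q : seq level_tree,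
  is_walk (G := level_tree) (level_proj x) q (level_proj y) & size q <= size p.
Proof.
elim: p x => [|z p IH] x [/= xp lp]; first by exists [::]; rewrite // -lp.
case/andP: xp => xz zp; have [q zq sq] := IH z (conj zp lp).
have [->|xz'] := level_adj_proj xz; first by exists q => //; exact: leqW.
exists (level_proj z :: q); last by rewrite /= ltnS.
by case: zq => zq lq; split=> //=; rewrite xz'.
Qed.

Lemma level_tree_connected (u v : level_tree) : exists p, is_walk u p v.
Proof.
have [p /level_walk[q + _]] := Gc (val u) (val v).
by rewrite !level_projK; exists q.
Qed.

(** A node of maximal level on a cycle would have two different parents. *)
Lemma level_tree_is_tree : is_tree level_tree.
Proof.
split; first by split; [constructor;
  exact: level_proj o|exact: level_tree_connected].
move=> c sc /andP[cc uc].
have [u uin umax] : exists2 u, u \in c & forall v, v \in c ->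
  node_level v <= node_level u.
  case: c sc {cc uc} => // a c _; elim: c a => [|b c IH] a.
    by exists a; rewrite ?mem_head // => v; rewrite inE => /eqP->.
  have [u uc um] := IH b; case: (leqP (node_level a) (node_level u)) => au.
    by exists u; [rewrite inE uc orbT|move=> v; rewrite inE => /orP[/eqP->|/um]].
  exists a; first exact: mem_head.
  move=> v; rewrite inE => /orP[/eqP->//|/um vu]; exact: leq_trans vu (ltnW au).
have [i c' rc] := rot_to uin.
have sub v : v \in u :: c' -> node_level v <= node_level u.
  by rewrite -rc mem_rot; exact: umax.
move: cc uc sc; rewrite -(rot_cycle i) -(rot_uniq i) -(size_rot i) rc.
case: c' sub {rc} => [//|v c'] sub; case/lastP: c' sub => [//|c' w] sub.
rewrite /= rcons_path last_rcons => /andP[uv /andP[_ wu]] /andP[_ /andP[vw _]] _.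
move: vw; rewrite mem_rcons inE negb_or => /andP[/eqP + _]; apply.
have lt (z : level_tree) : level_adj u z -> node_level z <= node_level u ->
    node_level z < node_level u.
  by move=> /level_adjP[x [y [_ _ _ []]]]; lia.
have uw : level_adj u w by rewrite level_adj_sym.
apply: (@level_lower_unique u) => //; apply: lt => //; apply: sub.
  by rewrite !inE eqxx orbT.
by rewrite !inE mem_rcons inE eqxx !orbT.
Qed.

(* [m] is a lower bound for the levels met by the walk. *)
Lemma level_tree_walk (u v : level_tree) p : is_walk u p v -> exists m,
  [/\ m <= node_level u, m <= node_level v,
      conn [set z | m <= level z] (val u) (val v) &
      node_level u + node_level v <= m.*2 + size p].
Proof.
elim: p u => [|w p IH] u [/= up lp].
  by rewrite -lp; exists (node_level u); split=> //;
    [exact: (conn_refl (leqnn _))|lia].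
case/andP: up => uw wp; have [m [mw mv cm lem]] := IH w (conj wp lp).
have [x [y [xy [_ c1] [_ c2] [e1 e2 xy1]]]] := level_adjP uw.
rewrite -!/(node_level _) in c1 c2.
have lem' : node_level u + node_level v <= (minn m (node_level u)).*2 + (size p).+1.
  by move: lem; move: (size p) => n; lia.
exists (minn m (node_level u)); split=> //; [lia|lia|].
apply: (@conn_trans _ _ _ x); first by apply: conn_sub c1 => z /=; lia.
apply: (@conn_trans _ _ _ y); first by apply: conn_edge => //=; lia.
apply: (@conn_trans _ _ _ (val w)).
  by apply: conn_sym; apply: conn_sub c2 => z /=; lia.
by apply: conn_sub cm => z /=; lia.
Qed.

(** The error is at most three times [d]: from [x] and [y] to the representatives of their nodes,
    and once between the feet of two descents to the lowest level [m] of a tree walk. *)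
Lemma level_tree_quasi_isometry (R : realType) (d : nat) :
  (forall x y, level_conn x y -> dist Gc x y <= d) ->
  is_quasi_isometry R (level_proj : G -> level_tree).
Proof.
move=> dP; apply: (@quasi_isometry_of_dist R _ _ _ Gc level_tree_connected (d + d
  + d)).
- move=> x y; have [p /level_walk[q xq sq] <-] := distP Gc x y.
  by have := dist_le level_tree_connected xq; lia.
- move=> x y;
    have [p xp <-] := distP level_tree_connected (level_proj x) (level_proj y).
  have [m [mx my cm lem]] := level_tree_walk xp.
  move: (size p) lem => n; rewrite /node_level; move: mx my cm.
  rewrite /node_level; set u := val _; set v := val _ => mx my cm lem.
  have xu : level_conn x u := level_proj_val x.
  have yv : level_conn y v := level_proj_val y.
  (* The descent follows a geodesic from [w] to the root down to level [m]. *)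
  have down w : m <= level w -> exists w', [/\ level w' = m,
      dist Gc w' w = level w - m & conn [set z | m <= level z] w' w].
    move=> mw; have [w' ow' ww'] := geodesic_point mw; exists w'; split=> //.
    apply: conn_sub (conn_geodesic Gc w' w) => z /= zw.
    by have := dist_triangle Gc z o w; move: mw ow' ww'; rewrite /level; lia.
  have [u' [lu du cu]] := down u mx; have [v' [lv dv cv]] := down v my.
  have uv : level_conn u' v'.
    split; first by rewrite lu lv.
    by rewrite lu; apply: conn_trans cu (conn_trans cm (conn_sym cv)).
  have := dP _ _ xu; have := dP _ _ yv; have := dP _ _ uv.
  have := dist_triangle Gc u x y; have := dist_triangle Gc u' u y.
  have := dist_triangle Gc v' u' y; have := dist_triangle Gc v v' y.
  rewrite (dist_sym Gc u u') (dist_sym Gc v y).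
  by move: lem du dv mx my; clear; lia.
- by move=> u; exists (val u); exact: level_projK.
Qed.

(* Failure of Manning's bottleneck property at the midpoint of a geodesic. *)
Lemma far_level_conn_bypass (d : nat) x y :
  level_conn x y -> (6 * d).+1 < dist Gc x y ->
  exists2 m, dist Gc x m + dist Gc m y = dist Gc x y &
    conn [set z | d < dist Gc m z] x y.
Proof.
move=> [lxy cxy] far.
(* [m] is a midpoint, hence more than [3 * d] away from both ends. *)
have [|m xm my] := @geodesic_point _ Gc x y (dist Gc x y)./2; first lia.
exists m; first lia.
have [p xp lep] := cxy.
have [/hasP[z0 /lep/= z0p mz0]|/hasPn far_p] :=
  boolP (has (fun z => dist Gc m z <= d) (x :: p)).
  (* The connection passes within [d] of [m] at [z0], so [m] is at most [d] below the level of [x].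
     A geodesic from [w] to the root is within [d] of [m] only if [w] is within [3 * d] of [m];
     hence the detour through the root. *)
  have away w : level w = level x -> 3 * d < dist Gc w m ->
      conn [set z | d < dist Gc m z] w o.
    move=> lw wm; apply: conn_sub (conn_geodesic Gc w o) => z /= wz.
    rewrite ltnNge; apply/negP => mz.
    have := dist_triangle Gc z w m; have := dist_triangle Gc m o z0.
    have := dist_triangle Gc z o m; rewrite (dist_sym _ z m).
    move: wz lw wm z0p; rewrite /level (dist_sym _ w o) (dist_sym _ z o); lia.
  apply: (@conn_trans _ _ _ o); first by apply: away => //; lia.
  by apply: conn_sym; apply: away; rewrite ?lxy // dist_sym; lia.
by exists p => // z /far_p; rewrite -ltnNge.
Qed.

End LevelTree.

(** * Grids around a vertex that can be bypassed *)

Section Grid.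
Variables (G : graph) (Gc : forall x y : G, exists p, is_walk x p y).
Hypotheses (lf : locally_finite G) (qt : quasi_transitive G).
Implicit Types m x y : G.

Definition bypass m d := exists x y,
  dist Gc x m + dist Gc m y = dist Gc x y /\ conn [set z | d < dist Gc m z] x y.

(** If each orbit representative failed for some radius, one common radius would fail for all of
    them and, by symmetry, at every vertex. *)
Lemma bypass_center : (forall d, exists m, bypass m d) ->
  exists m, forall d, bypass m d.
Proof.
move=> all_d; apply: contrapT => no_m.
have [reps repsP] := quasi_transitive_reps qt.
have [||d dP] := @uniform_bound G reps (fun m d => ~ bypass m d).
- by move=> m; apply/existsNP => mP; apply: no_m; exists m.
- move=> m d d' dd' nb [x [y [xy c]]]; apply: nb; exists x, y; split=> //.
  by apply: conn_sub c => z /=; exact: leq_ltn_trans.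
have [m [x [y [xy c]]]] := all_d d; have [m0 [f [m0r fP fm]]] := repsP m.
have [g [gP fg gf]] := automorphism_inv fP.
apply: (dP m0 m0r); exists (g x), (g y).
have <- : g m = m0 by rewrite -fm fg.
rewrite !dist_automorphism //; split=> //.
apply: conn_sub (conn_automorphism gP gf c) => z /=.
by rewrite -{2}[z]fg dist_automorphism.
Qed.

(** The sphere of radius [r.+1] is finite, so one walk for each joinable pair on it suffices, and
    [r'] bounds these walks. *)
Lemma annulus_conn m r : exists r', r < r' /\ forall u v,
  dist Gc m u = r.+1 -> dist Gc m v = r.+1 ->
  conn [set z | r < dist Gc m z] u v -> conn [set z | r < dist Gc m z <= r'] u v.
Proof.
have [s sP] := ball_finite Gc m r.+1 lf.
pose P (uv : G * G) n := conn [set z | r < dist Gc m z] uv.1 uv.2 ->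
  conn [set z | r < dist Gc m z <= n] uv.1 uv.2.
have [||n nP] := @uniform_bound _ [seq (u, v) | u <- s, v <- s] P.
- move=> uv; have [[p wp pP]|nc] :=
    pselect (conn [set z | r < dist Gc m z] uv.1 uv.2).
    exists (\max_(z <- uv.1 :: p) dist Gc m z) => _; exists p => // z zp.
    by rewrite /= pP //=; apply: (leq_bigmax_seq (F := dist Gc m)).
  by exists 0.
- move=> uv i j ij Pi /Pi; apply: conn_sub => z /= /andP[-> zi];
    exact: leq_trans ij.
exists (maxn n r.+1); split; first by lia.
move=> u v mu mv uv; have := nP (u, v) _ uv; rewrite allpairs_f ?sP ?mu ?mv //.
by move=> /(_ isT); apply: conn_sub => z /=; lia.
Qed.

(** [c] is where the path leaves the ball of radius [r] for the last time, or its start if it is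
    never inside. *)
Lemma sphere_crossing m r a p : path (@adj G) a p ->
  dist Gc m a <= r.+1 -> r < dist Gc m (last a p) ->
  exists2 c, c \in a :: p & dist Gc m c = r.+1 /\
    conn [set z | r < dist Gc m z] c (last a p).
Proof.
move=> ap ma mb.
suff [out|//] : (forall z, z \in a :: p -> r < dist Gc m z) \/
    exists2 c, c \in a :: p & dist Gc m c = r.+1 /\
      conn [set z | r < dist Gc m z] c (last a p).
  have := out a (mem_head _ _) => ra; exists a; first exact: mem_head.
  by split; [lia|exists p].
elim: p a ap mb {ma} => [|b p IH] a /=; first by move=> _ mb; left=> z;
  rewrite inE => /eqP->.
case/andP=> ab bp mb; have [out|[c cp cP]] := IH b bp mb; last first.
  by right; exists c => //; rewrite inE cp orbT.
case: (ltnP r (dist Gc m a)) => ra.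
  by left=> z; rewrite inE => /orP[/eqP->|/out].
right; exists b; first by rewrite !inE eqxx orbT.
have := out b (mem_head _ _); have := dist_adjS Gc m ab => h1 h2.
by split; [lia|exists p].
Qed.

(** * Disjoint connected sets between a ball and a far walk *)

Section Fan.
Variables (n r : nat) (m x y : G) (q : seq G).
Hypothesis tight_r : forall (v : G) (W : set G) (S : seq G),
  (forall z, dist Gc v z <= r -> W z) -> size S <= n -> v \in S -> tight W S ->
  forall s, s \in S -> dist Gc v s <= r.
Hypothesis geo : dist Gc x m + dist Gc m y = dist Gc x y.
Hypothesis xq : is_walk x q y.
Hypothesis farq : forall z, z \in x :: q -> r.+2 < dist Gc m z.

(** Menger's theorem is applied inside the ball of this radius. The margin beyond the walk leaves
    room for balls of radius [r] around the points of geodesics from [m] to the walk. *)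
Let R := \max_(z <- x :: q) dist Gc m z + r.+2.
(** Minimal separators consist of such vertices, so their removal leaves the ball around [m] and the
    walk intact. *)
Let inn z := (r < dist Gc m z) && (z \notin x :: q).

Variable s : seq G.
Hypothesis sP : forall z, (z \in s) = (dist Gc m z <= R).

Let T := seq_sub s.
Let e : rel T := fun u v : T => [&& adj (val u) (val v), inn (val u) & inn (val v)].
Let A : {set T} :=
  [set u : T | inn (val u) && `[< exists2 a, dist Gc m a <= r & adj a (val u)
    >]]%SET.
Let B : {set T} := [set u : T | inn (val u) && has (@adj G (val u)) (x :: q)]%SET.

Let leR z : z \in x :: q -> dist Gc m z + r.+2 <= R.
Proof. by move=> zq; rewrite leq_add2r;
  apply: (leq_bigmax_seq (F := dist Gc m)). Qed.

Let xin : x \in x :: q. Proof. exact: mem_head. Qed.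
Let yin : y \in x :: q. Proof. by case: xq => _ <-; exact: mem_last. Qed.

Let path_inn (a : T) p (z : T) : inn (val a) -> path e a p -> z \in a :: p ->
  inn (val z).
Proof.
elim: p a => [|b p IH] a ia /=; first by move=> _; rewrite inE => /eqP->.
case/andP=> /and3P[_ _ ib] bp; rewrite inE => /orP[/eqP->//|]; exact: IH.
Qed.

(** A minimal separator below this size is tight between [m] and [x]. It meets geodesics from [m] to
    [x] and to [y] in [s1] and [s2], whose distance is at most [r] by [tight_r], but by [geo] at
    least the sum of their distances to [m], both larger than [r]. *)
Let separator_large (S : {set T}) : separates e A B S -> n <= #|S|.
Proof.
move=> sepS; rewrite leqNgt; apply/negP => ltS.
have [S0 /minsetP[/asboolP sep0 min0] S0S] := minset_exists (P :=
  fun S => `[< separates e A B S >]) (asboolT sepS).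
have {S0S ltS} leS0 : #|S0| <= n by apply: leq_trans (subset_leq_card S0S) (ltnW
  ltS).
pose Ss := [seq val u | u <- enum S0].
have SsP (u : T) : (val u \in Ss) = (u \in S0).
  by rewrite mem_map ?mem_enum //; exact: val_inj.
pose W := [set z | dist Gc m z <= R].
have valW (u : T) : W (val u) by rewrite /W /= -sP; exact: valP.
pose E := W `\` [set` Ss].
(* By minimality, each vertex of [S0] is the only one of [S0] on some path from [A] to [B]. *)
have through t : t \in S0 -> exists a p, [/\ a \in A, path e a p, last a p \in B,
    t \in a :: p & forall z, z \in a :: p -> z \in S0 -> z = t].
  move=> tS0; apply: contrapT => nap.
  have sep1 : separates e A B (S0 :\ t)%SET.
    move=> a p aA ap pB; apply: contrapT => nz; apply: nap; exists a, p.
    have zt z : z \in a :: p -> z \in S0 -> z = t.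
      move=> zp zS; apply/eqP/negPn/negP => ne; apply: nz; exists z => //.
      by rewrite in_setD1 ne.
    split=> //; have [z zp zS] := sep0 a p aA ap pB; by rewrite -(zt z zp zS).
  have := min0 (S0 :\ t)%SET (asboolT sep1) (subsetDl _ _).
  by move=> /setP/(_ t); rewrite in_setD1 eqxx tS0.
have S0inn t : t \in S0 -> inn (val t).
  move=> /through[a [p [aA ap _ tp _]]]; apply: path_inn ap tp.
  by move: aA; rewrite inE => /andP[].
have SsE z : z \in Ss -> inn z.
  by move=> /mapP[t]; rewrite mem_enum => /S0inn ? ->.
have ballE z : dist Gc m z <= r -> E z.
  move=> mz; split; first by rewrite /W /R /=; lia.
  by move=> /SsE /andP[]; rewrite ltnNge mz.
have qE z : z \in x :: q -> E z.
  move=> zq; split; first by have := leR zq; rewrite /W /=; lia.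
  by move=> /SsE /andP[_]; rewrite zq.
have cball z : dist Gc m z <= r -> conn E m z.
  move=> mz; apply: conn_sub (conn_ball (x := m) (n := r) _ mz) => [w|];
    first exact: ballE.
  by rewrite distxx.
have cq z : z \in x :: q -> conn E x z.
  move=> zq; have [xq1 _] := xq.
  case/splitPl: zq xq1 qE => q1 q2 lz; rewrite cat_path => /andP[xq1 _] qE'.
  exists q1; first by split.
  by move=> w wq1; apply: qE'; rewrite -cat_cons mem_cat wq1.
have nmx : ~ conn E m x.
  move=> mx.
  (* Invariant along a walk from [m]: the vertex is in the ball or ends a path from [A] that misses
     [S0]. Stepping onto [x :: q] would put the end of that path in [B]. *)
  have : dist Gc m x <= r \/ exists a p, [/\ a \in A, path e a p,
      (forall z, z \in a :: p -> z \notin S0) & val (last a p) = x].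
    apply: (conn_inv (P :=
      fun z => dist Gc m z <= r \/ exists a p, [/\ a \in A, path e a p,
      (forall z, z \in a :: p -> z \notin S0) & val (last a p) = z]) mx).
      by left; rewrite distxx.
    move=> u v Pu Eu Ev uv; case: (leqP (dist Gc m v) r) => mv; [by left|right].
    have mvS := dist_adjS Gc m uv.
    have vq : v \notin x :: q.
      apply/negP => vq; have fv := farq vq; case: Pu => [|[a [p [aA ap nS lu]]]];
        first lia.
      have [z zp zS] : exists2 z, z \in a :: p & z \in S0.
        apply: sep0 => //; rewrite inE; apply/andP; split.
          by apply: path_inn ap (mem_last _ _); move: aA; rewrite inE => /andP[].
        by apply/hasP; exists v; rewrite // lu.
      by have := nS z zp; rewrite zS.
    have iv : inn v by rewrite /inn mv vq.
    have vs : v \in s by rewrite sP; case: Ev.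
    pose v' : T := SeqSub vs.
    have vS : v' \notin S0 by rewrite -SsP; apply/negP; case: Ev.
    case: Pu => [mu|[a [p [aA ap nS lu]]]].
      exists v', [::]; split=> // [|z]; last by rewrite inE => /eqP->.
      by rewrite inE iv; apply/asboolP; exists u.
    exists a, (rcons p v'); rewrite last_rcons; split=> //.
      rewrite rcons_path ap /e lu uv iv andbT /=.
      rewrite -lu; apply: path_inn ap (mem_last _ _).
      by move: aA; rewrite inE => /andP[].
    move=> z; rewrite -rcons_cons mem_rcons inE => /orP[/eqP->//|]; exact: nS.
  move=> [|[a [p [aA ap _ lx]]]]; first by have := farq xin; lia.
  have : inn (val (last a p)).
    by apply: path_inn ap (mem_last _ _); move: aA; rewrite inE => /andP[].
  by rewrite lx => /andP[_]; rewrite xin.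
have EvalN (u t : T) : (u \in S0 -> u = t) -> u != t -> E (val u).
  move=> uS ut; split; first exact: valW.
  by rewrite /= SsP => /uS /eqP; rewrite (negbTE ut).
(* If no neighbour of [t] were in the component of [m], following the path from [a] would never
   reach [t] and would lead on to [x]. *)
have nbA t : t \in S0 -> exists2 u, adj (val t) u & conn E m u.
  move=> tS0; have [a [p [aA ap pB tp pt]]] := through t tS0.
  apply: contrapT => nt; apply: nmx.
  have bx b : b \in B -> conn E m (val b) -> conn E m x.
    rewrite inE => /andP[_ /hasP[z zq bz]] mb; apply: (conn_trans mb).
    apply: conn_trans (conn_sym (cq z zq)); apply: conn_edge => //;
      first exact: conn_r mb.
    exact: qE.
  apply: (bx _ pB).
  have ma : conn E m (val a).
    move: aA; rewrite inE => /andP[_ /asboolP[a0 ma0 aa0]].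
    have [at_|at_] := eqVneq a t.
      by case: nt; exists a0; [rewrite -at_ adj_sym|exact: cball].
    apply: conn_trans (cball _ ma0) _; apply: conn_edge => //; first exact: ballE.
    by apply: EvalN at_ => aS; apply: pt => //; exact: mem_head.
  elim: p a ap pt ma {aA pB tp} => [//|b p IH] a /= /andP[/and3P[ab _ _] bp] pt ma.
  apply: IH => // [z zp|]; first by apply: pt; rewrite inE zp orbT.
  have [bt|bt] := eqVneq b t.
    by case: nt; exists (val a); rewrite // -bt adj_sym.
  apply: conn_trans (ma) _; apply: conn_edge => //; first exact: conn_r ma.
  by apply: EvalN bt => bS; apply: pt => //; rewrite !inE eqxx orbT.
(* The same argument, with the path traversed backwards from its end in [B]. *)
have nbB t : t \in S0 -> exists2 u, adj (val t) u & conn E x u.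
  move=> tS0; have [a [p [aA ap pB tp pt]]] := through t tS0.
  apply: contrapT => nt; apply: nmx.
  suff xa : conn E x (val a).
    move: aA; rewrite inE => /andP[_ /asboolP[a0 ma0 aa0]].
    apply: conn_trans (cball _ ma0) _; apply: conn_trans (conn_sym (xa)).
    by apply: conn_edge => //; [exact: ballE|exact: conn_r xa].
  have EvalU (u : T) p' : (forall z, z \in u :: p' -> z \in S0 -> z = t) ->
      forall w, adj (val u) w -> conn E x w -> conn E x (val u).
    move=> pt' w uw xw; have [ut|ut] := eqVneq u t.
      by case: nt; exists w; rewrite // -ut.
    apply: conn_trans (xw) _; apply: conn_edge;
      [exact: conn_r xw| |by rewrite adj_sym].
    by apply: EvalN ut => uS; apply: pt' => //; exact: mem_head.
  elim: p a ap pt pB {aA tp} => [|b p IH] a /= ap pt pB.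
    move: pB; rewrite inE => /andP[_ /hasP[z zq az]].
    exact: (EvalU _ _ pt z az (cq z zq)).
  case/andP: ap => /and3P[ab _ _] bp; apply: (EvalU _ _ pt (val b)) => //.
  by apply: IH => // z zp; apply: pt; rewrite inE zp orbT.
have tightS : tight W Ss.
  split; first by move=> z /mapP[t _ ->]; exact: valW.
  exists m, x; split=> // z /mapP[t]; rewrite mem_enum => tS0 ->.
  by split; [exact: nbA|exact: nbB].
have hit w : w \in x :: q ->
  exists t, t \in Ss /\ dist Gc m t + dist Gc t w = dist Gc m w.
  move=> wq; have [p mp pP] := geodesicP Gc m w.
  apply: contrapT => nt; apply: nmx; apply: conn_trans (conn_sym (cq w wq)).
  exists p => // z zp; split.
    by have := pP z zp; have := leR wq; rewrite /W /=; lia.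
  by move=> zS; apply: nt; exists z; split=> //; exact: pP.
have [s1 [s1S e1]] := hit x xin; have [s2 [s2S e2]] := hit y yin.
have s12 : dist Gc s1 s2 <= r.
  apply: (tight_r (W := W) (S := Ss)) => //; last by rewrite size_map -cardE.
  move=> z sz; have := dist_triangle Gc s1 m z; have := leR xin; rewrite /W /=; lia.
have := SsE _ s1S; have := SsE _ s2S => /andP[m2 _] /andP[m1 _].
have := dist_triangle Gc s1 x y; have := dist_triangle Gc s2 s1 y.
move: geo e1 e2 s12 m1 m2; rewrite (dist_sym Gc x m) (dist_sym Gc x s1); lia.
Qed.

Lemma fan_in_ball : exists U : 'I_n -> set G,
  trivIset setT U /\ forall i, exists a b, [/\ dist Gc m a <= r.+1,
    exists2 z, z \in x :: q & adj z b, U i b &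
    forall v, U i v -> conn (U i) a v].
Proof.
(* Vertices of [A] are within [r.+1] of [m] and their neighbours within [r.+2], short of the
   walk. *)
have dAB : fintype.disjoint (mem A) (mem B).
  rewrite fintype.disjoint_subset; apply/fintype.subsetP => u;
    rewrite !inE => /andP[_ /asboolP[a ma au]].
  apply/negP => /andP[_ /hasP[z zq uz]]; have := farq zq.
  by have := dist_adjS Gc m au; have := dist_adjS Gc m uz; lia.
have [U [dU UP]] := menger dAB separator_large.
exists (fun i => [set val u | u in [set` U i]]); split.
  apply/trivIsetP => i j _ _ ij; apply/seteqP;
    split=> // z [[u ui <-] [v vj /val_inj uv]].
  by rewrite uv /= in vj ui; have := disjointFr (dU i j ij) ui; rewrite vj.
move=> i; have [a [b [aA bB bU Uc]]] := UP i; exists (val a), (val b); split.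
- move: aA; rewrite inE => /andP[_ /asboolP[a0 ma0 aa0]].
  by apply: leq_trans (dist_adjS Gc m aa0) _; rewrite ltnS.
- by move: bB; rewrite inE => /andP[_ /hasP[z zq bz]]; exists z; rewrite // adj_sym.
- by exists b.
- move=> _ [v vU <-]; have [p [ap <- pU]] := Uc v vU.
  exists (map val p).
    split; last by rewrite last_map.
    by rewrite path_map; apply: sub_path ap => u w /and3P[].
  by move=> z; rewrite -map_cons => /mapP[w /pU wU ->]; exists w.
Qed.

End Fan.

(** Rows come from [fan_in_ball], columns lie in consecutive annuli. All rows lead to the far walk,
    which connects their crossings outside each inner ball; [annulus_conn] moves these connections
    into the annulus. *)
Lemma grid (m : G) (n : nat) : (forall d, bypass m d) ->
  exists U K : 'I_n -> set G, [/\ trivIset setT U, trivIset setT K,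
    (forall i u v, U i u -> U i v -> conn (U i) u v),
    (forall j u v, K j u -> K j v -> conn (K j) u v) &
    forall i j, U i `&` K j !=set0].
Proof.
move=> mP; have [r tight_r] := tight_bounded Gc n lf qt.
have /choice[nx nxP] := annulus_conn m.
pose rad j := iter j nx r.
have radS j : rad j < rad j.+1 by rewrite /rad iterS; case: (nxP (iter j nx r)).
have rad_le i j : i <= j -> rad i <= rad j.
  by elim: j => [|j IH];
    [rewrite leqn0 => /eqP->|rewrite leq_eqVlt => /orP[/eqP->//|/IH];
    have := radS j; lia].
(* The walk runs beyond all annuli; [.+2] is the margin that [fan_in_ball] asks for. *)
have [x [y [geo [q xq farq]]]] := mP (rad n).+2.
have rn := rad_le 0 n (leq0n n); have {rn} rn : r <= rad n := rn.
have farq' z : z \in x :: q -> r.+2 < dist Gc m z by move=> /farq /=; lia.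
have [s sP] := ball_finite Gc m (\max_(z <- x :: q) dist Gc m z + r.+2) lf.
have [U [tU UP]] := fan_in_ball tight_r geo xq farq' sP.
have cU i u v : U i u -> U i v -> conn (U i) u v.
  have [a [b [_ _ _ ca]]] := UP i => /ca/conn_sym au /ca; exact: conn_trans.
have /choice[c cP] : forall ij : 'I_n * 'I_n, exists c, [/\ U ij.1 c,
    dist Gc m c = (rad ij.2).+1 & conn [set z | rad ij.2 < dist Gc m z] c x].
  move=> [i j] /=; have [a [b [ma [z zq zb] bU ca]]] := UP i.
  have rj := rad_le j n (ltnW (ltn_ord j)).
  have r0 := rad_le 0 j (leq0n j); have {r0} r0 : r <= rad j := r0.
  have fz := farq z zq; have bz := dist_adjS Gc m (_ : adj b z).
  have {}bz : dist Gc m z <= (dist Gc m b).+1 by apply: bz; rewrite adj_sym.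
  have [p [ap lp] pU] := ca b bU.
  have [||c0 cp [mc cb]] := sphere_crossing (m := m) (r := rad j) ap.
  - lia.
  - by rewrite lp; move: fz => /=; lia.
  exists c0; split=> //; first exact: pU.
  apply: conn_trans cb _; rewrite lp; apply: (@conn_trans _ _ _ z).
    by apply: conn_edge; rewrite /= ?[adj b z]adj_sym //; move: fz => /=; lia.
  have [xq1 _] := xq; apply: conn_sym; case/splitPl: zq xq1 farq => q1 q2 lz.
  rewrite cat_path => /andP[xq1 _] fq; exists q1; first by split.
  by move=> w wq; have /= := fq w; rewrite -cat_cons mem_cat wq => /(_ isT); lia.
pose ann j := [set z | rad j < dist Gc m z <= rad j.+1].
(* Column [j] is the component of its annulus that contains the crossing of row [j], and hence those
   of all other rows. *)
pose K (j : 'I_n) := [set z | conn (ann j) (c (j, j)) z].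
exists U, K; split=> //.
- apply/trivIsetP => i j _ _ ij; apply/seteqP; split=> // z [/conn_r iz /conn_r jz].
  have {}iz : rad i < dist Gc m z <= rad i.+1 := iz.
  have {}jz : rad j < dist Gc m z <= rad j.+1 := jz.
  case: (ltngtP i j) ij => [ltij|ltji|eij] ij.
  - by have := rad_le _ _ ltij; move: iz jz; lia.
  - by have := rad_le _ _ ltji; move: iz jz; lia.
  - by case/eqP: ij; apply: val_inj.
- move=> j u v ju jv.
  by apply: conn_trans (conn_sym (conn_component ju)) (conn_component jv).
- move=> i j; have [ic im ix] := cP (i, j); have [_ jm jx] := cP (j, j).
  exists (c (i, j)); split=> //; have [_ nxj] := nxP (rad j).
  by apply: nxj => //; apply: conn_trans jx (conn_sym ix).
Qed.

End Grid.

(** * The prism over a graph *)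

Section Prism.
Variable G : graph.

(** The Cartesian product of [G] with a single edge. *)
Definition prism_adj : rel (G * bool) := fun u v =>
  (u.2 == v.2) && adj u.1 v.1 || (u.1 == v.1) && (u.2 != v.2).

Fact prism_adj_sym : symmetric prism_adj.
Proof.
by move=> u v; rewrite /prism_adj adj_sym (eq_sym u.1) (eq_sym u.2).
Qed.

Fact prism_adj_irrefl : irreflexive prism_adj.
Proof. by move=> u; rewrite /prism_adj adj_irrefl !eqxx. Qed.

Definition prism : graph := Graph prism_adj_sym prism_adj_irrefl.

Lemma prism_locally_finite : locally_finite G -> locally_finite prism.
Proof.
move=> lf x; have [nb nbE] := (finite_seqP _).1 (lf x.1).
pose s := (x.1, ~~ x.2) :: [seq (z, x.2) | z <- nb].
apply: (sub_finite_set (B := [set` s])); last exact: finite_seq.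
case=> z b /orP[/= /andP[/eqP <- xz]|/= /andP[/eqP <- xb]]; rewrite /s inE.
  apply/orP; right; apply: map_f; suff : [set` nb] z by []; by rewrite -nbE.
by apply/orP; left; rewrite -pair_eqE /= eqxx; case: x.2 b xb => [] [].
Qed.

Lemma prism_quasi_transitive : quasi_transitive G -> quasi_transitive prism.
Proof.
move=> /quasi_transitive_reps[s sP].
apply: (@reps_quasi_transitive prism [seq (v, b) | v <- s, b <- [:: true; false]]).
case=> u b; have [v [f [vs [fb fadj] fv]]] := sP u.
exists (v, b), (fun z : prism => (f z.1, z.2)); split; last by rewrite /= fv.
  by apply: allpairs_f => //; case: b.
case: fb => g fg gf; split.
  by exists (fun z => (g z.1, z.2)) => -[z c]; rewrite /= ?fg ?gf.
move=> x y; rewrite /= /prism_adj /= fadj.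
by congr (_ || _ && _); apply/eqP/eqP => [/(can_inj fg)|->].
Qed.

Lemma prism_conn (b : bool) (D : set G) (E : set prism) (u v : G) :
  (forall z, D z -> E (z, b)) -> conn D u v -> conn E (u, b) (v, b).
Proof.
move=> DE [p [up lp] pD]; exists [seq (z, b) | z <- p].
  split; last by rewrite last_map lp.
  by rewrite path_map; apply: sub_path up => z w /= zw;
    rewrite /prism_adj /= eqxx zw.
by move=> z; rewrite -map_cons => /mapP[w /pD wD ->]; exact: DE.
Qed.

Variable Gc : forall x y : G, exists p, is_walk x p y.

Lemma prism_walk (x y : prism) : exists2 p : seq prism, is_walk x p y &
  size p <= dist Gc x.1 y.1 + 1.
Proof.
case: x y => [u b] [v c]; have [p [up lp] sp] := distP Gc u v.
have wp : path (@adj prism) (u, b) [seq (z, b) | z <- p].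
  by rewrite path_map; apply: sub_path up => z w /= zw;
    rewrite /prism_adj /= eqxx zw.
have [<-|bc] := eqVneq b c.
  exists [seq (z, b) | z <- p]; first by split; rewrite // last_map lp.
  by rewrite size_map /= -sp leq_addr.
exists (rcons [seq (z, b) | z <- p] (v, c));
  last by rewrite size_rcons size_map /= -sp addn1.
split; last by rewrite last_rcons.
by rewrite rcons_path wp last_map lp /= /prism_adj /= eqxx bc orbT.
Qed.

Lemma prism_connected (x y : prism) : exists p, is_walk x p y.
Proof. by have [p xp _] := prism_walk x y; exists p. Qed.

Lemma prism_quasi_isometric (R : realType) : quasi_isometric R prism G.
Proof.
exists fst; apply: (@quasi_isometry_of_dist R _ _ _ prism_connected Gc 1).
- move=> x y; have [p xp <-] := distP prism_connected x y.
  apply: leq_trans (leq_addr _ _); elim: p x xp => [|z p IH] x [/= xp lp].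
    by rewrite lp distxx.
  case/andP: xp => xz zp; have zy := IH z (conj zp lp).
  apply: leq_trans (dist_triangle Gc z.1 _ _) _; rewrite -[leqRHS]add1n.
  apply: leq_add zy; case/orP: xz => /andP[]; first by move=> _; exact: dist_adj.
  by move=> /eqP-> _; rewrite distxx.
- by move=> x y; have [p xp] := prism_walk x y; apply: leq_trans; exact: dist_le.
- by move=> z; exists (z, true).
Qed.

(* Row [i] in one copy of [G] together with column [i] in the other one is the
   [i]-th branch set of a complete minor. *)
Lemma prism_minor (F : graph) :
  (forall n, exists U K : 'I_n -> set G, [/\ trivIset setT U, trivIset setT K,
    (forall i u v, U i u -> U i v -> conn (U i) u v),
    (forall j u v, K j u -> K j v -> conn (K j) u v) &
    forall i j, U i `&` K j !=set0]) ->
  finite_graph F -> is_minor F prism.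
Proof.
move=> gridG /finite_seqP[s sE].
have sP (v : F) : index v s < size s.
  by rewrite index_mem; suff : [set` s] v by []; rewrite -sE.
pose f v := Ordinal (sP v).
have finj : injective f.
  move=> u v /(congr1 val) /= uv; have := sP u; have := sP v;
    rewrite !index_mem => vs us.
  by rewrite -(nth_index u us) uv nth_index.
have [U [K [tU tK cU cK UK]]] := gridG (size s).
pose B (v : F) : set prism := [set z | if z.2 then U (f v) z.1 else K (f v) z.1].
exists B; split.
- by move=> v; have [c [Uc Kc]] := UK (f v) (f v); exists (c, true).
- move=> u v _ _ [[z []] /= [uz vz]]; apply: finj.
    by apply: tU => //; exists z.
  by apply: tK => //; exists z.
- move=> v; have [c [Uc Kc]] := UK (f v) (f v).
  have toc z : B v z -> conn (B v) z (c, true).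
    case: z => z [] /= Bz; first by apply: prism_conn (cU _ _ _ Bz Uc).
    apply: (@conn_trans prism _ _ (c, false));
      first by apply: prism_conn (cK _ _ _ Bz Kc).
    by apply: conn_edge => //=; rewrite /prism_adj /= eqxx.
  apply: conn_induced; first by exists (c, true).
  by move=> x y /toc xc /toc/conn_sym; exact: conn_trans.
(* The rung over a common vertex of row [f u] and column [f v] joins the two branch sets. *)
- move=> u v _; have [c [Uc Kc]] := UK (f u) (f v); exists (c, true), (c, false).
  by split=> //=; rewrite /prism_adj /= eqxx.
Qed.

End Prism.

(** * Both directions of the equivalence *)

Theorem theorem1p1 (R : realType) (G : graph) (G_conn : graph_connected G)
    (G_lf : locally_finite G) (G_qt : quasi_transitive G) :
  (exists T : graph, is_tree T /\ quasi_isometric R G T) <->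
  (forall H : graph, locally_finite H -> quasi_transitive H ->
     quasi_isometric R H G -> minor_excluded H).
Proof.
have [[o] Gc] := G_conn; split.
  move=> [T [treeT [f fP]]] H lfH qtH [g gP].
  have Hc := quasi_isometry_connected gP Gc; have Tc := (treeT.1).2.
  have [C1 C1P] := quasi_isometry_dist Gc Tc fP.
  have [C2 C2P] := quasi_isometry_dist Hc Gc gP.
  apply: (@tree_like_minor_excluded H T (f \o g) treeT Hc Tc (C1 * C2 + C1 + C2))
    => //.
  move=> x y; have [a1 a2] := C1P (g x) (g y); have [b1 b2] := C2P x y.
  by move=> /=; split; nia.
move=> allH; apply: contrapT => noT.
(* A radius [d] without a bypass would bound the diameter of the classes of [level_conn] by
   [(6 * d).+1], making [G] quasi-isometric to its level tree. *)
have no_bound d : exists m, bypass Gc m d.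
  apply: contrapT => nd; apply: noT; exists (level_tree Gc o).
  split; first exact: level_tree_is_tree.
  exists (level_proj Gc o);
    apply: (@level_tree_quasi_isometry _ _ _ _ (6 * d).+1) => x y xy.
  rewrite leqNgt; apply/negP => far; apply: nd.
  by have [m mxy c] := far_level_conn_bypass xy far; exists m, x, y.
have [m mP] := bypass_center G_qt no_bound.
have [F finF] : minor_excluded (prism G).
  by apply: allH;
    [exact: prism_locally_finite|exact: prism_quasi_transitive|exact:
    prism_quasi_isometric].
by apply; apply: prism_minor finF => n; exact: grid mP.
Qed.
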